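(* For Lebesgue-almost every triangle $\Delta$ (in the space of triangles up to similarity, parametrized by two of its angles $(\alpha,\beta)$ ranging over $\{\alpha>0,\beta>0,\alpha+\beta<\pi\}$ with Lebesgue measure), for every vertex $v$ of $\Delta$ and every $\epsilon>0$, $$\liminf_{n\to\infty} P_n(v)\,e^{-n^{\sqrt{3}-1+\epsilon}}<\infty.$$
   Context: Consider the billiard in a triangle $\Delta$. A generalized diagonal is a billiard orbit segment that starts at a vertex of $\Delta$ and ends at a vertex of $\Delta$; its length is its number of reflections. For a vertex $v$ of $\Delta$, $P_n(v)$ denotes the number of generalized diagonals of length at most $n$ emanating from $v$. *)

(* Defs.v *)
From HB Require Import structures.
From mathcomp Require Import all_boot all_order all_algebra.
From mathcomp Require Import all_classical all_reals all_analysis.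
Set Implicit Arguments. Unset Strict Implicit. Unset Printing Implicit Defensive.
Import Order.TTheory GRing.Theory Num.Theory.
Local Open Scope ring_scope.
Local Open Scope classical_set_scope.

Section Billiard.
Variable R : realType.
Notation pt := (R * R)%type.

Definition padd (p q : pt) : pt := (p.1 + q.1, p.2 + q.2).
Definition psub (p q : pt) : pt := (p.1 - q.1, p.2 - q.2).
Definition pscale (t : R) (p : pt) : pt := (t * p.1, t * p.2).
Definition pdot (p q : pt) : R := p.1 * q.1 + p.2 * q.2.

(* The triangle with angle a at vertex 0 = (0,0), angle b at vertex 1 = (1,0),
   and third vertex 2 above the x-axis (law of sines). Every triangle up to
   similarity with angles (a, b, pi - a - b) is represented this way. *)
Definition vert (a b : R) (i : 'I_3) : pt :=
  match val i with
  | 0%N => (0, 0)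
  | 1%N => (1, 0)
  | _ => (sin b * cos a / sin (a + b), sin b * sin a / sin (a + b))
  end.

(* Side j is the side opposite vertex j; its endpoints: *)
Definition side_end1 (j : 'I_3) : 'I_3 := inord ((val j).+1 %% 3).
Definition side_end2 (j : 'I_3) : 'I_3 := inord ((val j).+2 %% 3).

Definition on_open_side (a b : R) (j : 'I_3) (p : pt) : Prop :=
  exists2 t : R, 0 < t < 1 &
    p = padd (pscale (1 - t) (vert a b (side_end1 j))) (pscale t (vert a b (side_end2 j))).

Definition in_open_triangle (a b : R) (p : pt) : Prop :=
  exists l0 l1 l2 : R, [/\ 0 < l0, 0 < l1, 0 < l2, l0 + l1 + l2 = 1 &
    p = padd (pscale l0 (vert a b 0))
             (padd (pscale l1 (vert a b 1)) (pscale l2 (vert a b 2)))].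

Definition reflect (u d : pt) : pt :=
  psub (pscale (2 * pdot d u / pdot u u) u) d.

Definition side_dir (a b : R) (j : 'I_3) : pt :=
  psub (vert a b (side_end2 j)) (vert a b (side_end1 j)).

(* A generalized diagonal from vertex v to vertex w whose successive
   reflection points are the elements of s (its length is size s):
   the polygonal path v, s_1, ..., s_k, w is a billiard orbit segment. *)
Definition gen_diag (a b : R) (v : 'I_3) (s : seq pt) (w : 'I_3) : Prop :=
  let pts := vert a b v :: rcons s (vert a b w) in
  [/\
      (forall p, p \in s -> exists j, on_open_side a b j p),
      (* each straight piece runs through the interior of the triangle *)
      (forall i, (i <= size s)%N ->
         in_open_triangle a b
           (pscale (2^-1) (padd (nth (0, 0) pts i) (nth (0, 0) pts i.+1)))) &
      (forall i j, (i < size s)%N ->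
         on_open_side a b j (nth (0, 0) pts i.+1) ->
         exists2 t : R, 0 < t &
           psub (nth (0, 0) pts i.+2) (nth (0, 0) pts i.+1) =
           pscale t (reflect (side_dir a b j)
                             (psub (nth (0, 0) pts i.+1) (nth (0, 0) pts i))))].

Definition P_count (a b : R) (v : 'I_3) (n : nat) : \bar R :=
  \esum_(x in [set x : seq pt * 'I_3 | gen_diag a b v x.1 x.2 /\ (size x.1 <= n)%N])
    1%E.

Definition triangle_params : set (R * R) :=
  [set ab | 0 < ab.1 /\ 0 < ab.2 /\ ab.1 + ab.2 < pi].

End Billiard.

(* Main.v *)
Require Import Defs.
From HB Require Import structures.
From mathcomp Require Import all_boot all_order all_algebra finmap complex.
From mathcomp Require Import all_classical all_reals all_analysis.
From mathcomp Require Import measurable_realfun.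
From mathcomp Require Import ring lra zify.
Set Implicit Arguments. Unset Strict Implicit. Unset Printing Implicit Defensive.
Import Order.TTheory GRing.Theory Num.Theory.
Import numFieldNormedType.Exports.
Local Open Scope ring_scope.
Local Open Scope classical_set_scope.

(** Unfold the billiard from [v]: a generalized diagonal becomes a straight segment from the
    origin to the apex of an unfolded copy of the triangle. Record a ray by the word of turns it
    makes at the successive apices; the rays with a given word form a cone, which branches when
    it meets the next apex. Hence [P_n(v)] is at most the number of words of length less than [n]
    with a nonempty cone.

    Cut time into windows of length [m] and place a grid of [K] rays. At most [K + 1] cones of a
    given length contain a grid ray. In the other cones, the apices met during a window lie
    within angle [1 / K] of each other, so any three of them span a triangle of tiny area. This
    area is a trigonometric polynomial in the angles with integer coefficients, of degree
    [O(m)], taken from a list of [exp (O(m))] polynomials. A polynomial of degree [O(m)] that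
    does not vanish identically is below [eps ^ O(m)] only on a set of measure [O(m eps)], so by
    Borel-Cantelli, for almost every triangle, a nonzero area is at least [exp (- C m ^ 2)].
    When [K] is much larger, all these areas vanish.

    Three apices are never aligned when the branch taken at the second one turns opposite to the
    branch taken at the first: along rays, the inverse of the distance to the current edge is an
    affine function that decreases from each edge to the next. So in a window all turns before a
    branching go the same way and a cone has at most [2 m + 1] descendants. Therefore
    [log P_n = O((n / m) log m + m + log K)] as soon as [log K] exceeds [m ^ 2] by a large
    factor, which gives every exponent above [2 / 3], in particular [sqrt 3 - 1]. *)

(** * The tree of unfolded copies of a triangle *)

Definition cross (R : pzRingType) (p q : R * R) : R := p.1 * q.2 - p.2 * q.1.

Section UnfoldingTree.
Variable R : realFieldType.
Implicit Types (l m : R) (w y : seq bool) (c : bool).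

Definition sgb c : R := if c then 1 else -1.

Lemma sgbN c : sgb (~~ c) = - sgb c.
Proof. by case: c => /=; rewrite ?opprK. Qed.

(* The apex lies beyond the edge [r, l] as seen from the origin and to the right of [d]. *)
Lemma cross_step_right (r l v d : R * R) :
  0 < cross r d -> 0 < cross d l -> 0 < cross r l -> 0 <= cross v d ->
  cross r l < cross v l + cross r v ->
  0 < cross v l /\
  (cross d l + cross v d) * cross r l < (cross d l + cross r d) * cross v l.
Proof.
move=> rd dl rl vd bey.
(* Plücker relation among the four plane vectors [r], [l], [v], [d]. *)
have plu : cross v l * cross r d = cross r v * cross d l + cross v d * cross r l.
  by rewrite /cross; ring.
have key : cross r l * (cross d l + cross v d) < cross v l * (cross r d + cross d l).
  have h : 0 < cross d l * (cross v l + cross r v - cross r l).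
    by rewrite mulr_gt0 // subr_gt0.
  by rewrite [ltRHS]mulrDr plu; lra.
split; last by rewrite mulrC [ltRHS]mulrC [_ + cross r d]addrC.
have : 0 < cross v l * (cross r d + cross d l).
  apply: le_lt_trans key; apply: mulr_ge0; first exact: ltW.
by apply: addr_ge0 vd; exact: ltW.
by rewrite pmulr_lgt0 // addr_gt0.
Qed.

Lemma cross_step_left (r l v d : R * R) :
  0 < cross r d -> 0 < cross d l -> 0 < cross r l -> cross v d <= 0 ->
  cross r l < cross v l + cross r v ->
  0 < cross r v /\
  (cross r d - cross v d) * cross r l < (cross d l + cross r d) * cross r v.
Proof.
move=> rd dl rl vd bey.
(* This reflection reverses the sign of [cross], hence exchanges left and right. *)
pose f (p : R * R) : R * R := (- p.1, p.2).
have fE p q : cross (f p) (f q) = cross q p by rewrite /cross /f /=; ring.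
have := @cross_step_right (f l) (f r) (f v) (f d).
have dvE : cross d v = - cross v d by rewrite /cross; ring.
rewrite !fE dvE oppr_ge0 (addrC (cross r v)) => /(_ dl rd rl vd bey) [h1 h2]; split=> //.
by rewrite (addrC (cross d l)).
Qed.

Lemma convex_gt0 (s p q : R) : 0 <= s <= 1 -> 0 < p -> 0 < q -> 0 < (1 - s) * p + s * q.
Proof.
move=> /andP[s0 s1] p0 q0; have [->|sN0] := eqVneq s 0; first by lra.
apply: ltr_wpDl; first by rewrite mulr_ge0 ?subr_ge0 // ltW.
by rewrite mulr_gt0 // lt_def sN0.
Qed.

(** The edge of [w] runs from [rt w] to [lf w], and [ap w] is the vertex of the copy beyond it. *)
Variables (rt lf ap : seq bool -> R * R).
Hypothesis rtS : forall c w, rt (c :: w) = if c then ap w else rt w.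
Hypothesis lfS : forall c w, lf (c :: w) = if c then lf w else ap w.
Hypothesis beyond :
  forall w, cross (rt w) (lf w) < cross (ap w) (lf w) + cross (rt w) (ap w).
Hypothesis root_gt0 : 0 < cross (rt [::]) (lf [::]).

Let kappa := cross (rt [::]) (lf [::]).

(** A ray is parametrized by the point of the first edge that it crosses, so that its cross product
    with a fixed vector is affine in [l]. *)
Definition ray l : R * R :=
  ((1 - l) * (rt [::]).1 + l * (lf [::]).1, (1 - l) * (rt [::]).2 + l * (lf [::]).2).

(* A word records, newest letter first, on which side of the ray the successive apices lie:
   [true] when the apex is on the right, so that the copy is left through its left edge. *)
Fixpoint incone l w : bool :=
  if w is c :: w' then incone l w' && (0 < sgb c * cross (ap w') (ray l))
  else 0 < l < 1.

Definition alive w := `[< exists l, incone l w >].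
Definition hits w l := incone l w && (cross (ap w) (ray l) == 0).
Definition hit w := `[< exists l, hits w l >].

(* Inverse distance from the origin to the edge of [w] along [ray l]: affine in [l]. *)
Definition invrad w l : R :=
  (cross (ray l) (lf w) + cross (rt w) (ray l)) / cross (rt w) (lf w).

Lemma cross_ray_ray l m : cross (ray l) (ray m) = (m - l) * kappa.
Proof. by rewrite /kappa /cross /ray /=; ring. Qed.

Lemma cross_ray_affine (p : R * R) l m s :
  cross p (ray (l + s * (m - l))) = (1 - s) * cross p (ray l) + s * cross p (ray m).
Proof. by rewrite /cross /ray /=; ring. Qed.

(** Induction on the word: as the apex lies beyond the current edge, the exit edge chosen by the
    turn straddles the ray again. *)
Lemma cone_edge l w : incone l w ->
  [/\ 0 < cross (rt w) (ray l), 0 < cross (ray l) (lf w) & 0 < cross (rt w) (lf w)].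
Proof.
elim: w => [|c w IH] /=.
  move=> /andP[l0 l1].
  have -> : cross (rt [::]) (ray l) = l * kappa by rewrite /kappa /cross /ray /=; ring.
  have -> : cross (ray l) (lf [::]) = (1 - l) * kappa.
    by rewrite /kappa /cross /ray /=; ring.
  by split=> //; rewrite mulr_gt0 // subr_gt0.
move=> /andP[/IH[rd dl rl]]; rewrite rtS lfS; case: c => /=.
  rewrite mul1r => vd.
  by have [] := cross_step_right rd dl rl (ltW vd) (beyond w).
rewrite mulN1r oppr_gt0 => vd; have [h _] := cross_step_left rd dl rl (ltW vd) (beyond w).
split=> //; move: vd; rewrite -oppr_gt0; congr (0 < _); rewrite /cross; ring.
Qed.

Lemma invrad_step l c w : incone l (c :: w) -> invrad (c :: w) l < invrad w l.
Proof.
move=> h; have [_ _ rl'] := cone_edge h; move: h => /= /andP[h].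
have [rd dl rl] := cone_edge h.
rewrite /invrad ltr_pdivrMr // mulrAC ltr_pdivlMr //; move: rl'; rewrite rtS lfS.
case: c => /= _.
  rewrite mul1r => vd.
  by have [] := cross_step_right rd dl rl (ltW vd) (beyond w).
rewrite mulN1r oppr_gt0 => vd; have [_] := cross_step_left rd dl rl (ltW vd) (beyond w).
suff -> : cross (ray l) (ap w) = - cross (ap w) (ray l) by rewrite addrC.
rewrite /cross; ring.
Qed.

Lemma incone_cat l y w : incone l (y ++ w) -> incone l w.
Proof. by elim: y => //= c y IH /andP[/IH]. Qed.

Lemma invrad_cat l y w : incone l (y ++ w) -> invrad (y ++ w) l <= invrad w l.
Proof.
elim: y => //= c y IH /[dup] h /andP[/IH le _].
exact: le_trans (ltW (@invrad_step l c (y ++ w) h)) le.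
Qed.

(** This is the boundary case of [cross_step_right], with the apex on the ray itself. *)
Lemma hitsP w l : hits w l ->
  exists t, [/\ 0 < t, ap w = (t * (ray l).1, t * (ray l).2), t^-1 < invrad w l &
    t * kappa = cross (ap w) ((lf [::]).1 - (rt [::]).1, (lf [::]).2 - (rt [::]).2)].
Proof.
move=> /andP[h /eqP vd]; have [rd dl rl] := cone_edge h.
have vd0 : 0 <= cross (ap w) (ray l) by rewrite vd.
have [vl key] := cross_step_right rd dl rl vd0 (beyond w).
exists (cross (ap w) (lf w) / cross (ray l) (lf w)); split.
- exact: divr_gt0.
- have dl0 := lt0r_neq0 dl.
  rewrite [LHS]surjective_pairing; congr (_, _); rewrite mulrAC;
    apply: (canRL (mulfK dl0)); apply/eqP; rewrite -subr_eq0; apply/eqP.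
    transitivity (- (lf w).1 * cross (ap w) (ray l)); last by rewrite vd mulr0.
    by rewrite /cross; ring.
  transitivity (- (lf w).2 * cross (ap w) (ray l)); last by rewrite vd mulr0.
  by rewrite /cross; ring.
- rewrite invf_div /invrad ltr_pdivrMr // mulrAC ltr_pdivlMr //.
  by move: key; rewrite vd addr0.
- have dl0 := lt0r_neq0 dl; rewrite mulrAC; apply: (canLR (mulfK dl0)); apply/eqP.
  rewrite -subr_eq0; apply/eqP.
  transitivity (cross (ap w) (ray l) *
     ((lf w).1 * ((lf [::]).2 - (rt [::]).2) - (lf w).2 * ((lf [::]).1 - (rt [::]).1)));
    last by rewrite vd mul0r.
  by rewrite /kappa /cross /ray /=; ring.
Qed.

(** Consequently a hit cuts the cone exactly at [l]: the sign of [m - l] decides the side of the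
    apex. *)
Lemma cross_hits w l : hits w l -> exists2 t, 0 < t &
  forall m, cross (ap w) (ray m) = t * (m - l).
Proof.
move=> /hitsP[t [t0 E _ _]]; exists (t * kappa); first exact: mulr_gt0.
move=> m; rewrite -mulrA (mulrC kappa) -cross_ray_ray E /cross /ray /=; ring.
Qed.

Lemma hits_inj w l m : hits w l -> hits w m -> l = m.
Proof.
move=> /cross_hits[t t0 E] /andP[_]; rewrite E mulf_eq0 gt_eqF //=.
by rewrite subr_eq0 => /eqP.
Qed.

Lemma incone_convex w l m s : 0 <= s <= 1 -> incone l w -> incone m w ->
  incone (l + s * (m - l)) w.
Proof.
move=> s01; elim: w => [|c w IH] /=.
  move=> /andP[l0 l1] /andP[m0 m1].
  have := convex_gt0 s01 l0 m0.
  have : 0 < (1 - s) * (1 - l) + s * (1 - m) by rewrite convex_gt0 // subr_gt0.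
  by move=> h1 h2; apply/andP; split; lra.
move=> /andP[/IH + l0] /andP[hm m0] => /(_ hm) -> /=.
rewrite cross_ray_affine; move: l0 m0.
set p := cross _ _; set q := cross _ _ => l0 m0.
have -> : sgb c * ((1 - s) * p + s * q) = (1 - s) * (sgb c * p) + s * (sgb c * q) by ring.
exact: convex_gt0.
Qed.

Lemma alive_catl y w : alive (y ++ w) -> alive w.
Proof. by move=> /asboolP[l /incone_cat h]; apply/asboolP; exists l. Qed.

Lemma hit_alive w : hit w -> alive w.
Proof. by move=> /asboolP[l /andP[h _]]; apply/asboolP; exists l. Qed.

Lemma cross_zero_between w l m :
  incone l w -> incone m w -> 0 < cross (ap w) (ray l) -> cross (ap w) (ray m) < 0 ->
  hit w.
Proof.
move=> hl hm; set p := cross _ (ray l); set q := cross _ (ray m) => p0 q0.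
have pq : 0 < p - q by rewrite subr_gt0 (lt_trans q0).
apply/asboolP; exists (l + (p / (p - q)) * (m - l)); apply/andP; split.
  apply: incone_convex => //; apply/andP; split; first by apply: divr_ge0; exact: ltW.
  by rewrite ler_pdivrMr // mul1r lerDl oppr_ge0 ltW.
rewrite cross_ray_affine -/p -/q; apply/eqP; field; exact: lt0r_neq0.
Qed.

(** The two children see the apex on opposite sides; by convexity some ray of the cone in between
    goes through it. *)
Lemma alive_both w : alive (true :: w) -> alive (false :: w) -> hit w.
Proof.
move=> /asboolP[l /= /andP[hl]]; rewrite mul1r => l0.
move=> /asboolP[m /= /andP[hm]]; rewrite mulN1r oppr_gt0 => m0.
exact: cross_zero_between hl hm l0 m0.
Qed.

Lemma incone_size_inj l w w' : size w = size w' -> incone l w -> incone l w' -> w = w'.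
Proof.
elim: w w' => [|c w IH] [|c' w'] //= [sz] /andP[hw hc] /andP[hw' hc'].
have ww := IH _ sz hw hw'; rewrite -ww in hc' *; congr (_ :: _).
by move: hc hc'; case: c; case: c' => //=; rewrite mul1r mulN1r oppr_gt0 => a b;
   have := lt_trans a b; rewrite ltxx.
Qed.

Lemma sign_nohit w c l m : ~~ hit w -> incone l w -> incone m w ->
  0 < sgb c * cross (ap w) (ray l) -> 0 < sgb c * cross (ap w) (ray m).
Proof.
move=> ns hl hm.
have nz k : incone k w -> cross (ap w) (ray k) != 0.
  by move=> hk; apply: contra ns => z; apply/asboolP; exists k; rewrite /hits hk.
have [m0|m0|/eqP] := ltgtP (cross (ap w) (ray m)) 0; last by rewrite (negbTE (nz _ hm)).
  have [l0|l0|/eqP] := ltgtP (cross (ap w) (ray l)) 0; last by rewrite (negbTE (nz _ hl)).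
    by case: c; rewrite ?mul1r ?mulN1r; lra.
  by case/negP: ns; exact: cross_zero_between hl hm l0 m0.
have [l0|l0|/eqP] := ltgtP (cross (ap w) (ray l)) 0; last by rewrite (negbTE (nz _ hl)).
  by case/negP: ns; exact: cross_zero_between hm hl m0 l0.
by case: c; rewrite ?mul1r ?mulN1r; lra.
Qed.

(* The cone of [w] is bounded, on the side opposite to turn [c], by [l1]. *)
Definition bounded_at c l1 w := forall l, incone l w ->
  0 < sgb c * (l - l1) /\ (forall s, 0 < s <= 1 -> incone (l1 + s * (l - l1)) w).

Lemma bounded_at_turn c l1 w : hits w l1 -> bounded_at c l1 (c :: w).
Proof.
move=> sp l /= /andP[hl]; have [t t0 E] := cross_hits sp.
rewrite E mulrCA pmulr_rgt0 // => cl; split=> // s /andP[s0 s1].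
case/andP: (sp) => h1 _; rewrite incone_convex ?(ltW s0) //= E mulrCA pmulr_rgt0 //.
have -> : l1 + s * (l - l1) - l1 = s * (l - l1) by ring.
by rewrite mulrCA mulr_gt0.
Qed.

(** A turn opposite to [c] at a hit cuts the cone at its other end, away from [l1]; without a hit
    nothing is cut. *)
Lemma bounded_at_cons c c' l1 w : bounded_at c l1 w -> (hit w -> c' = ~~ c) ->
  bounded_at c l1 (c' :: w).
Proof.
move=> b hc l /= /andP[hl lc]; have [cl hs] := b _ hl; split=> // s s01.
rewrite hs //=; case: (boolP (hit w)) => [|ns]; last first.
  exact: sign_nohit ns hl (hs _ s01) lc.
move=> /[dup] /hc E /asboolP[l2 /cross_hits[t t0 Et]]; move: lc.
rewrite {}E !Et !(mulrCA _ t) !(pmulr_rgt0 _ t0) sgbN !mulNr !oppr_gt0 => lc.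
case/andP: s01 => s0 s1.
have -> : sgb c * (l1 + s * (l - l1) - l2) =
  sgb c * (l - l2) - (1 - s) * (sgb c * (l - l1)) by ring.
rewrite subr_lt0 (lt_le_trans lc) // mulr_ge0 ?subr_ge0 //; exact: ltW.
Qed.

(** Only turns at hits are constrained: elsewhere the cone lies on one side of the apex and the turn
    is forced. *)
Fixpoint allturn c y w : bool :=
  if y is c' :: y' then (hit (y' ++ w) ==> (c' == c)) && allturn c y' w else true.

(** Take the latest hit with turn [c]: it bounds the cone at [l1], and every later hit turns the
    other way, which preserves that bound. *)
Lemma allturn_or_bounded c y w : allturn (~~ c) y w \/
  exists y' p l1, [/\ y = y' ++ c :: p, hits (p ++ w) l1 & bounded_at c l1 (y ++ w)].
Proof.
elim: y => [|c' y [IH|[y' [p [l1 [E sp b]]]]]]; first by left.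
  have [/asboolP[l1 sp]|ns] := boolP (hit (y ++ w)); last by left; rewrite /= IH (negbTE ns).
  have [E|cc] := eqVneq c' c.
    by right; exists [::], y, l1; rewrite E; split=> //; exact: bounded_at_turn.
  by left; rewrite /= IH andbT; apply/implyP => _; move: cc; case: c' c {IH} => [] [].
have [/asboolP[l2 sp2]|ns] := boolP (hit (y ++ w)).
  have [Ec|cc] := eqVneq c' c.
    by right; exists [::], y, l2; rewrite Ec; split=> //; exact: bounded_at_turn.
  right; exists (c' :: y'), p, l1; rewrite E; split=> //; rewrite -E.
  by apply: bounded_at_cons => // _; move: cc; case: c' c {E b} => [] [].
right; exists (c' :: y'), p, l1; rewrite E; split=> //; rewrite -E.
by apply: bounded_at_cons => //; rewrite (negbTE ns).
Qed.

(** Each letter is determined: by [c] at a hit, and by [alive_both] elsewhere. *)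
Lemma allturn_inj c y y' w : size y = size y' -> allturn c y w -> allturn c y' w ->
  alive (y ++ w) -> alive (y' ++ w) -> y = y'.
Proof.
elim: y y' => [|c1 y IH] [|c2 y'] //= [sz] /andP[t1 a1] /andP[t2 a2] v1 v2.
have vt c3 z : alive (c3 :: z ++ w) -> alive (z ++ w) by rewrite -cat1s => /alive_catl.
have E := IH _ sz a1 a2 (vt _ _ v1) (vt _ _ v2); rewrite -{}E in t2 v2 *.
congr (_ :: _); move: t1 t2; case: (boolP (hit (y ++ w))) => /= [_ /eqP-> /eqP->//|ns _ _].
by case: c1 c2 v1 v2 => [] [] // v1 v2; case/negP: ns; apply: alive_both.
Qed.

Lemma invrad_affine w l m s :
  invrad w (l + s * (m - l)) = (1 - s) * invrad w l + s * invrad w m.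
Proof. by rewrite /invrad !mulrA -mulrDl; congr (_ / _); rewrite /cross /ray /=; ring. Qed.

(** The apex is an endpoint of the exit edge for either turn. *)
Lemma invrad_hit c w l t : 0 < t -> ap w = (t * (ray l).1, t * (ray l).2) ->
  0 < cross (rt (c :: w)) (lf (c :: w)) -> invrad (c :: w) l = t^-1.
Proof.
move=> t0 E; rewrite /invrad rtS lfS.
have tu : t \is a GRing.unit by rewrite unitfE lt0r_neq0.
case: c => p; apply: (canLR (mulfK (lt0r_neq0 p))); rewrite E /cross /=; field;
  exact: lt0r_neq0.
Qed.

(** * Twice the signed area of the triangle spanned by three apices *)

Definition area (p1 p2 p3 : seq bool) : R :=
  cross ((ap p2).1 - (ap p1).1, (ap p2).2 - (ap p1).2)
        ((ap p3).1 - (ap p1).1, (ap p3).2 - (ap p1).2).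

Lemma area_rays p1 p2 p3 l1 l2 l3 t1 t2 t3 :
  ap p1 = (t1 * (ray l1).1, t1 * (ray l1).2) ->
  ap p2 = (t2 * (ray l2).1, t2 * (ray l2).2) ->
  ap p3 = (t3 * (ray l3).1, t3 * (ray l3).2) ->
  area p1 p2 p3 =
    kappa * (t2 * t3 * (l3 - l2) + t1 * t2 * (l2 - l1) - t1 * t3 * (l3 - l1)).
Proof. by move=> E1 E2 E3; rewrite /area E1 E2 E3 /kappa /cross /ray /=; ring. Qed.

(** Limit at [s = 0], used to reach the bounding ray [l1], which is not itself in the open cone. *)
Lemma limit_le0 (x y : R) :
  (forall s, 0 < s <= 1 -> (1 - s) * x + s * y <= 0) -> x <= 0.
Proof.
move=> h; rewrite leNgt; apply/negP => x0.
have d0 : 0 < x + `|y| by rewrite ltr_wpDr.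
have s0 : 0 < x / (2 * (x + `|y|)) by rewrite divr_gt0 // mulr_gt0.
have s1 : x / (2 * (x + `|y|)) <= 1.
  rewrite ler_pdivrMr ?mulr_gt0 // mul1r; have := normr_ge0 y; lra.
have := h _ (introT andP (conj s0 s1)).
have E : x / (2 * (x + `|y|)) * (x + `|y|) = x / 2 by field; exact: lt0r_neq0.
have := ler_wpM2l (ltW s0) (ler_norm (- y)); rewrite normrN.
move: E; set s := x / _ => E; lra.
Qed.

(* Through the apices of [p1] and [p2] passes a line whose inverse radius dominates, between
   the two rays, that of the edge entered after [p2]; later apices lie beyond that edge. *)
Lemma area_neq0 c p1 p2 p3 y2 y3 l1 l2 l3 :
  p2 = y2 ++ c :: p1 -> p3 = y3 ++ (~~ c) :: p2 ->
  hits p1 l1 -> hits p2 l2 -> hits p3 l3 -> bounded_at c l1 p2 ->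
  area p1 p2 p3 != 0.
Proof.
move=> E2 E3 s1 s2 s3 b2.
have b3 : bounded_at c l1 (~~ c :: p2) by apply: bounded_at_cons.
case/andP: (s3) => h3; rewrite E3 in h3; move: (incone_cat h3) => h3'.
have [c3 hs3] := b3 _ h3'; have [c2 _] := b2 _ (proj1 (andP s2)).
have [_ _ den3] := cone_edge h3'.
case/andP: (h3') => _; have [t2' t2'0 ->] := cross_hits s2.
rewrite mulrCA pmulr_rgt0 // sgbN mulNr oppr_gt0 => c23.
have [t1 [t10 A1 _ _]] := hitsP s1.
have [t2 [t20 A2 _ _]] := hitsP s2.
have [t3 [t30 A3 lt3 _]] := hitsP s3.
move=> _.
have G2 := invrad_hit t20 A2 den3.
have G3 : t3^-1 < invrad (~~ c :: p2) l3.
  by apply: lt_le_trans lt3 _; rewrite E3; exact: invrad_cat.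
have h31 : incone l3 (c :: p1).
  by apply: (@incone_cat _ (~~ c :: y2)); rewrite cat_cons -E2.
have [_ _ den1] := cone_edge h31.
have H1 := invrad_hit t10 A1 den1.
(* On the rays of the cone, the edge after [p2] is no nearer than the edge after [p1], which passes
   through the apex of [p1]; the comparison extends to [l1] by a limit. *)
have G1 : invrad (~~ c :: p2) l1 <= t1^-1.
  rewrite -subr_le0 -H1.
  apply: (@limit_le0 _ (invrad (~~ c :: p2) l3 - invrad (c :: p1) l3)) => s s01.
  have hm := hs3 _ s01.
  have : invrad (~~ c :: p2) (l1 + s * (l3 - l1)) <= invrad (c :: p1) (l1 + s * (l3 - l1)).
    by move: hm; rewrite E2 -cat_cons; exact: invrad_cat.
  by rewrite !invrad_affine; lra.
pose s := (l3 - l1) / (l2 - l1).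
have l21 : l2 - l1 != 0 by apply: contraTneq c2 => ->; rewrite mulr0 ltxx.
have El3 : l3 = l1 + s * (l2 - l1) by rewrite /s mulfVK //; ring.
have s_lt1 : s < 1.
  move: c23; have -> : l3 - l2 = - (1 - s) * (l2 - l1) by rewrite {1}El3; ring.
  by rewrite mulrCA mulNr oppr_lt0 pmulr_lgt0 // subr_gt0.
rewrite (area_rays A1 A2 A3).
(* The area vanishes only if [t3^-1] is the value at [l3] of the affine function equal to [t1^-1] at
   [l1] and to [t2^-1] at [l2]. *)
have -> : t2 * t3 * (l3 - l2) + t1 * t2 * (l2 - l1) - t1 * t3 * (l3 - l1) =
  t1 * t2 * t3 * (l2 - l1) * (t3^-1 - ((1 - s) * t1^-1 + s * t2^-1)).
  by rewrite El3; field; rewrite !lt0r_neq0.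
rewrite !mulf_eq0 (negbTE l21) (gt_eqF root_gt0) (gt_eqF t10) (gt_eqF t20) (gt_eqF t30) /=.
rewrite subr_eq0 lt_eqF // (lt_le_trans G3) //.
by rewrite {1}El3 invrad_affine G2 lerD2r ler_wpM2l // subr_ge0 ltW.
Qed.

(** The first hit that breaks a constant pattern of turns gives [p2]; the latest earlier hit with
    the other turn gives [p1]. *)
Lemma turns_or_bounded y w : [\/ allturn true y w, allturn false y w |
  exists c y3 y2 p1 l1, let p2 := y2 ++ c :: p1 in [/\ y = y3 ++ (~~ c) :: p2,
    hits (p1 ++ w) l1, hit (p2 ++ w) & bounded_at c l1 (p2 ++ w)]].
Proof.
elim: y => [|c' z IH]; first by constructor 1.
suff H b : allturn b z w -> [\/ allturn b (c' :: z) w, allturn (~~ b) (c' :: z) w |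
    exists c y3 y2 p1 l1, let p2 := y2 ++ c :: p1 in [/\ c' :: z = y3 ++ (~~ c) :: p2,
    hits (p1 ++ w) l1, hit (p2 ++ w) & bounded_at c l1 (p2 ++ w)]].
  case: IH => [/H //|/H[h|h|h]|[c [y3 [y2 [p1 [l1 [-> ? ? ?]]]]]]].
  - by constructor 2.
  - by constructor 1.
  - by constructor 3.
  - by constructor 3; exists c, (c' :: y3), y2, p1, l1.
move=> hb; have [sp|ns] := boolP (hit (z ++ w)); last first.
  by constructor 1; rewrite /= hb (negbTE ns).
have [E|cb] := eqVneq c' b; first by constructor 1; rewrite /= hb E eqxx implybT.
have {cb}E : c' = ~~ b by move: cb; case: c' b {hb} => [] [].
have [hn|[y2 [p1 [l1 [Ez s1 b1]]]]] := allturn_or_bounded b z w.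
  by constructor 2; rewrite /= hn E eqxx implybT.
by constructor 3; exists b, [::], y2, p1, l1; rewrite /= -Ez E.
Qed.

Definition flat w n := forall y1 y2 y3, (size (y3 ++ y2 ++ y1) < n)%N ->
  hit (y1 ++ w) -> hit (y2 ++ y1 ++ w) -> hit (y3 ++ y2 ++ y1 ++ w) ->
  area (y1 ++ w) (y2 ++ y1 ++ w) (y3 ++ y2 ++ y1 ++ w) = 0.

(** Two earlier hits with opposite turns would span with the apex of [y ++ w] a nonzero area, by
    [area_neq0]. *)
Lemma flat_turns w n y : flat w n -> (size y < n)%N -> hit (y ++ w) ->
  allturn true y w \/ allturn false y w.
Proof.
move=> fl sz sp; case: (turns_or_bounded y w) => [h|h|]; [by left|by right|].
move=> [c [y3 [y2 [p1 [l1 [E s1 s2 b]]]]]]; case/asboolP: sp => l3 s3.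
case/asboolP: (s2) => l2 s2'; exfalso.
have E2 : (y2 ++ c :: p1) ++ w = y2 ++ c :: p1 ++ w by rewrite -catA.
have E3 : y ++ w = y3 ++ (~~ c) :: (y2 ++ c :: p1) ++ w by rewrite E -catA.
have /eqP[] := area_neq0 E2 E3 s1 s2' s3 b.
have := fl p1 (y2 ++ [:: c]) (y3 ++ [:: ~~ c]).
rewrite -!catA /= -E2 -E3; apply=> //.
- by move: sz; rewrite E.
- by apply/asboolP; exists l1.
- by apply/asboolP; exists l3.
Qed.

(** * Counting the live descendants of a cone *)

Fixpoint words n : seq (seq bool) :=
  if n is n'.+1 then map (cons true) (words n') ++ map (cons false) (words n') else [:: [::]].

Lemma mem_words n w : (w \in words n) = (size w == n).
Proof.
elim: n w => [|n IH] w; first by rewrite /= inE size_eq0.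
rewrite mem_cat; case: w => [|c w].
  by apply/negbTE/negP => /orP[] /mapP[].
have mem c' : (c :: w \in map (cons c') (words n)) = (c == c') && (size w == n).
  apply/mapP/andP => [[z zn [-> ->]]|[/eqP-> h]]; first by rewrite eqxx -IH.
  by exists w => //; rewrite IH.
by rewrite !mem /= eqSS {mem}; case: c; rewrite /= ?orbF.
Qed.

Lemma uniq_words n : uniq (words n).
Proof.
elim: n => //= n IH; rewrite cat_uniq !map_inj_uniq ?IH; try by move=> x y [].
by rewrite andbT; apply/hasPn => z /mapP[x _ ->]; apply/negP => /mapP[].
Qed.

Lemma count_words_cat (P : pred (seq bool)) i t :
  count P (words (i + t)) = (\sum_(w <- words t) count (fun y => P (y ++ w)) (words i))%N.
Proof.
elim: i P => [|i IH] P.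
  by rewrite /= add0n -sum1_count big_mkcond; apply: eq_bigr => w _; rewrite addn0; case: P.
rewrite addSn /= count_cat !count_map !IH -big_split; apply: eq_bigr => w _ /=.
by rewrite count_cat !count_map.
Qed.

Lemma count_le1 (T : eqType) (P : pred T) (s : seq T) : uniq s ->
  {in s &, forall u v, P u -> P v -> u = v} -> (count P s <= 1)%N.
Proof.
move=> us inj; rewrite -size_filter.
have : uniq (seq.filter P s) by exact: filter_uniq.
have : {in seq.filter P s &, forall u v, u = v}.
  by move=> u v; rewrite !mem_filter => /andP[Pu su] /andP[Pv sv]; exact: inj.
case: (seq.filter P s) => [|u [|v t]] // h /=; rewrite inE (h u v) ?eqxx //.
  exact: mem_head.
by rewrite inE mem_head orbT.
Qed.

Lemma sum_count (T : Type) (P : pred T) (s : seq T) : (\sum_(u <- s) P u)%N = count P s.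
Proof. by rewrite -sum1_count [RHS]big_mkcond; apply: eq_bigr => u _; case: (P u). Qed.

Definition leaves w i := count (fun y => alive (y ++ w)) (words i).

(** A live word has at most two live children, and has two only at a hit. *)
Lemma leavesS w i :
  (leaves w i.+1 <= leaves w i + count (fun y => hit (y ++ w)) (words i))%N.
Proof.
rewrite /leaves /= count_cat !count_map; elim: (words i) => //= y s IH.
have ha c : alive (c :: y ++ w) -> alive (y ++ w) by rewrite -cat1s => /alive_catl.
have := ha true; have := ha false; have := @alive_both (y ++ w).
case: (alive (true :: _)); case: (alive (false :: _)); case: (alive (y ++ w));
  case: (hit _) => //=; try (by move=> /(_ isT isT)); try (by move=> _ /(_ isT));
  try (by move=> _ _ /(_ isT)); move=> _ _ _; lia.
Qed.

(** The factor [alive w] makes dead words contribute nothing when such bounds are summed over all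
    words. *)
Lemma leaves_exp w i : (leaves w i <= alive w * 2 ^ i)%N.
Proof.
elim: i => [|i IH]; first by rewrite /leaves /= addn0 expn0 muln1.
apply: leq_trans (leavesS w i) _; rewrite expnS mulnCA mul2n -addnn leq_add //.
by apply: leq_trans IH; apply: sub_count => y; exact: hit_alive.
Qed.

(* In a flat window all turns before a branching point go the same way, so that each level
   contains at most two branching points. *)
Lemma leaves_flat w i n : flat w n -> (i <= n)%N -> (leaves w i <= alive w * i.*2.+1)%N.
Proof.
move=> fl; case: (boolP (alive w)) => [_|na] le_in; last first.
  by have := leaves_exp w i; rewrite (negbTE na).
rewrite mul1n; elim: i le_in => [|i IH] le_in; first by rewrite /leaves /= addn0 leq_b1.
apply: leq_trans (leavesS w i) _.
have -> : i.+1.*2.+1 = (i.*2.+1 + 2)%N by rewrite doubleS addn2.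
apply: leq_add; first exact: IH (ltnW le_in).
pose Q c y := allturn c y w && alive (y ++ w).
have Q1 c : (count (Q c) (words i) <= 1)%N.
  apply: count_le1 (uniq_words i) _ => x y; rewrite !mem_words => /eqP sx /eqP sy.
  by move=> /andP[ax vx] /andP[ay vy]; apply: allturn_inj ax ay vx vy; rewrite sx sy.
apply: (@leq_trans (count (predU (Q true) (Q false)) (words i))).
  rewrite (@eq_in_count _ _ (fun y => (size y == i) && hit (y ++ w))); last first.
    by move=> y; rewrite mem_words => ->.
  apply: sub_count => y /andP[/eqP sy sp]; rewrite /= /Q (hit_alive sp) !andbT.
  by apply/orP; apply: flat_turns fl _ sp; rewrite sy.
have := count_predUI (Q true) (Q false) (words i); have := Q1 true; have := Q1 false; lia.
Qed.

(** * Narrow cones and the count over successive windows *)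

Section Grid.
Variable K : nat.
Hypothesis K_gt0 : (0 < K)%N.

Definition wide w := has (fun j => incone (j%:R / K%:R) w) (iota 0 K.+1).

(** A ray determines its word of turns, so each of the [K + 1] grid rays lies in at most one cone of
    length [t]. *)
Lemma count_wide t : (count wide (words t) <= K.+1)%N.
Proof.
rewrite /wide -[leqRHS](size_iota 0); elim: (iota 0 K.+1) => [|j s IH] /=.
  by rewrite count_pred0.
apply: (@leq_trans (count (incone (j%:R / K%:R)) (words t) +
    count (fun w => has (fun j => incone (j%:R / K%:R) w) s) (words t))%N).
  by rewrite -count_predUI leq_addr.
rewrite -add1n leq_add //.
apply: count_le1 (uniq_words t) _ => x y; rewrite !mem_words => /eqP sx /eqP sy.
by apply: incone_size_inj; rewrite sx sy.
Qed.

Lemma narrow_dist w l m : ~~ wide w -> incone l w -> incone m w -> `|m - l| <= K%:R^-1.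
Proof.
wlog lm : l m / l <= m.
  move=> H nw hl hm; case/orP: (le_total l m) => lm; first exact: H.
  by rewrite distrC; exact: H.
move=> nw hl hm; rewrite ger0_norm ?subr_ge0 // leNgt; apply/negP => lt.
have KR : 0 < K%:R :> R by rewrite ltr0n.
have in01 k : incone k w -> 0 < k < 1 by rewrite -(cats0 w) => /incone_cat.
have /andP[l0 l1] := in01 _ hl.
have exj : exists j, l < j%:R / K%:R by exists K; rewrite divff ?lt0r_neq0.
(* [j.+1] is the first grid index beyond [l]; were [m - l] larger than [1 / K], its ray would fall
   between [l] and [m], hence in the cone. *)
case: (ex_minnP exj) => -[|j] lj minj.
  by move: lj; rewrite mul0r ltNge ltW.
have jl : j%:R / K%:R <= l by rewrite leNgt; apply/negP => /minj; rewrite ltnn.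
have jm : j.+1%:R / K%:R < m by move: jl lt; rewrite -natr1 mulrDl mul1r; lra.
have jK : (j.+1 <= K)%N.
  have /andP[_ m1] := in01 _ hm.
  by have := lt_trans jm m1; rewrite ltr_pdivrMr // mul1r ltr_nat; exact: ltnW.
case/negP: nw; apply/hasP; exists j.+1; first by rewrite mem_iota.
have ml : 0 < m - l by rewrite subr_gt0 (lt_trans lj).
have -> : j.+1%:R / K%:R = l + ((j.+1%:R / K%:R - l) / (m - l)) * (m - l).
  by rewrite divfK ?lt0r_neq0 //; ring.
apply: incone_convex => //; apply/andP; split.
  by rewrite divr_ge0 ?subr_ge0 // ltW.
by rewrite ler_pdivrMr // mul1r lerD2r ltW.
Qed.

(** At a hit, [hitsP] identifies this with [kappa] times the scale [t] of the apex on its ray. *)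
Definition height w := cross (ap w) ((lf [::]).1 - (rt [::]).1, (lf [::]).2 - (rt [::]).2).

(** By [area_rays] the area is [kappa] times three terms, each with two scales at most [B / kappa]
    and a gap between rays of at most [1 / K]. *)
Lemma narrow_area w y1 y2 y3 B : ~~ wide w ->
  hit (y1 ++ w) -> hit (y2 ++ w) -> hit (y3 ++ w) ->
  `|height (y1 ++ w)| <= B -> `|height (y2 ++ w)| <= B -> `|height (y3 ++ w)| <= B ->
  `|area (y1 ++ w) (y2 ++ w) (y3 ++ w)| <= 3 * B ^+ 2 / (kappa * K%:R).
Proof.
move=> nw /asboolP[l1 s1] /asboolP[l2 s2] /asboolP[l3 s3].
have [t1 [t10 A1 _]] := hitsP s1; rewrite -/(height _) => <-.
have [t2 [t20 A2 _]] := hitsP s2; rewrite -/(height _) => <-.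
have [t3 [t30 A3 _]] := hitsP s3; rewrite -/(height _) => <-.
have inc y l : hits (y ++ w) l -> incone l w by move=> /andP[/incone_cat].
have KR : 0 < K%:R :> R by rewrite ltr0n.
rewrite !normrM !(gtr0_norm t10) !(gtr0_norm t20) !(gtr0_norm t30) !(gtr0_norm root_gt0).
rewrite -!(ler_pdivlMr _ _ root_gt0) => B1 B2 B3.
rewrite (area_rays A1 A2 A3) normrM (gtr0_norm root_gt0).
have -> : 3 * B ^+ 2 / (kappa * K%:R) =
    kappa * ((B / kappa) * (B / kappa) * (3 / K%:R)).
  by field; rewrite !lt0r_neq0.
rewrite ler_pM2l //.
have bd (x y l m : R) : 0 < x -> 0 < y -> x <= B / kappa -> y <= B / kappa ->
    incone l w -> incone m w ->
    `|x * y * (l - m)| <= (B / kappa) * (B / kappa) * K%:R^-1.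
  move=> x0 y0 xB yB hl hm; rewrite !normrM (gtr0_norm x0) (gtr0_norm y0).
  apply: ler_pM; [by apply: mulr_ge0; exact: ltW| exact: normr_ge0| |exact: narrow_dist nw hm hl].
  by apply: ler_pM => //; exact: ltW.
have := bd _ _ _ _ t20 t30 B2 B3 (inc _ _ s3) (inc _ _ s2).
have := bd _ _ _ _ t10 t20 B1 B2 (inc _ _ s2) (inc _ _ s1).
have := bd _ _ _ _ t10 t30 B1 B3 (inc _ _ s3) (inc _ _ s1).
set u := _ * (l3 - l1); set v := _ * (l2 - l1); set z := _ * (l3 - l2).
move=> hu hv hz; apply: le_trans (ler_normB _ _) _.
apply: le_trans (lerD (ler_normD _ _) (lexx _)) _.
by move: hu hv hz; rewrite (mulrA _ 3) (mulrAC _ 3); lra.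
Qed.

Variables (m q : nat) (B : R).
Hypothesis height_le : forall w, (size w < q * m)%N -> `|height w| <= B.
Hypothesis area_gap : forall w y2 y3, (size y2 < m)%N -> (size y3 < m)%N ->
  area w (y2 ++ w) (y3 ++ y2 ++ w) != 0 ->
  3 * B ^+ 2 / (kappa * K%:R) < `|area w (y2 ++ w) (y3 ++ y2 ++ w)|.

Lemma narrow_flat w : ~~ wide w -> (size w + m <= q * m)%N -> flat w m.
Proof.
move=> nw sz y1 y2 y3; rewrite !size_cat => lt s1 s2 s3.
apply/eqP; apply: contraT => nz.
have := @area_gap (y1 ++ w) y2 y3 _ _ nz; rewrite ltNge !(catA _ _ w).
rewrite (@narrow_area w y1 (y2 ++ y1) (y3 ++ y2 ++ y1)) -?catA //;
  try (by apply: height_le; rewrite !size_cat; lia).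
by apply; lia.
Qed.

(** The few wide cones are allowed all [2 ^ m] descendants; the narrow ones are flat and have at
    most [2 m + 1]. *)
Lemma alive_count_step t : (t + m <= q * m)%N ->
  (count alive (words (m + t)) <= (K.+1 * 2 ^ m) + (m.*2.+1) * count alive (words t))%N.
Proof.
move=> tm; rewrite count_words_cat.
apply: (@leq_trans (\sum_(w <- words t) (wide w * 2 ^ m + m.*2.+1 * alive w))%N).
  rewrite !(big_seq_cond (fun=> true)) leq_sum // => w; rewrite mem_words andbT => /eqP sw.
  case: (boolP (wide w)) => [_|nw].
    by apply: leq_trans (leaves_exp w m) _; case: (alive w); lia.
  rewrite add0n mulnC; apply: (leaves_flat (narrow_flat nw _)) => //; lia.
by rewrite big_split /= -big_distrl -big_distrr /= !sum_count leq_add2r leq_mul2r count_wide orbT.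
Qed.

(** The base [m.*2.+2] exceeds the factor of one step by 1 in order to absorb its additive term. *)
Lemma alive_count_mul i : (i <= q)%N ->
  (count alive (words (i * m)) <= (m.*2.+2) ^ i * (K.+1 * 2 ^ m))%N.
Proof.
elim: i => [|i IH] iq.
  by rewrite mul0n expn0 mul1n /= addn0 (leq_trans (leq_b1 _)) // muln_gt0 expn_gt0.
have {IH}le1 := IH (ltnW iq); rewrite mulSn.
have le2 : (K.+1 * 2 ^ m <= (m.*2.+2) ^ i * (K.+1 * 2 ^ m))%N by rewrite leq_pmull // expn_gt0.
apply: leq_trans (alive_count_step _) _; first by rewrite addnC -mulSn leq_mul2r iq orbT.
rewrite expnS -mulnA; move: le1 le2; set X := (_ ^ i * _)%N; set Y := (K.+1 * _)%N.
by move=> le1 le2; rewrite [leqRHS]mulSn leq_add // leq_mul2l le1 orbT.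
Qed.

(** The incomplete last window costs another factor [2 ^ m], whence [4 ^ m]. *)
Lemma alive_count_le t : (t <= q * m)%N ->
  (count alive (words t) <= (m.*2.+2) ^ q * (K.+1 * 4 ^ m))%N.
Proof.
move=> tq; have [m0|m0] := posnP m.
  have t0 : t = 0%N by move: tq; rewrite m0 muln0 leqn0 => /eqP.
  by rewrite t0 /= addn0 (leq_trans (leq_b1 _)) // !muln_gt0 !expn_gt0.
rewrite (divn_eq t m) addnC count_words_cat.
have iq : (t %/ m <= q)%N by rewrite -(leq_pmul2r m0) (leq_trans (leq_divM _ _)).
have := alive_count_mul iq; set T := (_ * m)%N => h.
apply: (@leq_trans (2 ^ m * count alive (words T))%N).
  rewrite -sum_count big_distrr leq_sum //= => w _.
  apply: leq_trans (leaves_exp w _) _; rewrite mulnC leq_mul2r leq_exp2l //.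
  by rewrite (ltnW (ltn_pmod _ _)) ?orbT.
apply: leq_trans (leq_mul (leqnn _) h) _.
rewrite (_ : 4 = 2 * 2)%N // expnMn mulnCA (mulnA K.+1) [(2 ^ m * _)%N]mulnC leq_mul2r.
by rewrite leq_exp2l // iq orbT.
Qed.

End Grid.
End UnfoldingTree.

(** * Unfolding a billiard orbit *)

Section TriangleAngles.
Variable R : realType.
Implicit Types (a b t : R) (i j k : 'I_3).

Definition ang a b i : R :=
  match val i with 0%N => a | 1%N => b | _ => pi - a - b end.

Lemma ord3P (P : 'I_3 -> Prop) : P (inord 0) -> P (inord 1) -> P (inord 2) -> forall i, P i.
Proof.
move=> p0 p1 p2 [[|[|[|//]]] h].
- by have -> : Ordinal h = inord 0 by apply/val_inj; rewrite /= inordK.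
- by have -> : Ordinal h = inord 1 by apply/val_inj; rewrite /= inordK.
- by have -> : Ordinal h = inord 2 by apply/val_inj; rewrite /= inordK.
Qed.

Lemma ord3_distinct (P : 'I_3 -> 'I_3 -> 'I_3 -> Prop) :
  P (inord 0) (inord 1) (inord 2) -> P (inord 1) (inord 2) (inord 0) ->
  P (inord 2) (inord 0) (inord 1) -> P (inord 1) (inord 0) (inord 2) ->
  P (inord 2) (inord 1) (inord 0) -> P (inord 0) (inord 2) (inord 1) ->
  forall i j k, uniq [:: i; j; k] -> P i j k.
Proof.
move=> h1 h2 h3 h4 h5 h6; apply: ord3P; apply: ord3P; apply: ord3P;
  by rewrite //= !inE -!val_eqE /= !inordK.
Qed.

Lemma ang0 a b : ang a b (inord 0) = a. Proof. by rewrite /ang /= inordK. Qed.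
Lemma ang1 a b : ang a b (inord 1) = b. Proof. by rewrite /ang /= inordK. Qed.
Lemma ang2 a b : ang a b (inord 2) = pi - a - b. Proof. by rewrite /ang /= inordK. Qed.
Definition angE := (ang0, ang1, ang2).

Lemma vert0 a b : vert a b (inord 0) = (0, 0). Proof. by rewrite /vert /= inordK. Qed.
Lemma vert1 a b : vert a b (inord 1) = (1, 0). Proof. by rewrite /vert /= inordK. Qed.
Lemma vert2 a b : vert a b (inord 2) =
  (sin b * cos a / sin (a + b), sin b * sin a / sin (a + b)).
Proof. by rewrite /vert /= inordK. Qed.
Definition vertE := (vert0, vert1, vert2).

Lemma ang_sum a b i j k : uniq [:: i; j; k] -> ang a b i + ang a b j + ang a b k = pi.
Proof.
by move: i j k; apply: ord3_distinct; rewrite !angE; ring.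
Qed.

Lemma sin_sum_pi (x y z : R) : x + y + z = pi -> sin z = sin x * cos y + cos x * sin y.
Proof.
move=> h; have -> : z = pi - (x + y) by rewrite -h; ring.
by rewrite sinB sinpi cospi sinD; ring.
Qed.

Lemma cos_sum_pi (x y z : R) : x + y + z = pi -> cos z = sin x * sin y - cos x * cos y.
Proof.
move=> h; have -> : z = pi - (x + y) by rewrite -h; ring.
by rewrite cosB sinpi cospi cosD; ring.
Qed.

Lemma ang_sin_gt0 a b i : triangle_params (a, b) -> 0 < sin (ang a b i).
Proof.
move=> [/= a0 [b0 ab]]; move: i; apply: ord3P; rewrite !angE;
  apply: sin_gt0_pi; apply/andP; split; lra.
Qed.

Notation pt := (R * R)%type.

Lemma pt_eq (p q : pt) : p.1 = q.1 -> p.2 = q.2 -> p = q.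
Proof. by case: p q => [? ?] [? ?] /= -> ->. Qed.

Definition cis (x : R) : pt := (cos x, sin x).

Lemma cos2sin2E (x : R) : cos x * cos x = 1 - sin x * sin x.
Proof. by rewrite -!expr2 cos2sin2. Qed.

(* Law of cosines in the triangle with side lengths [sin (ang a b i) / sin (a + b)]. *)
Lemma vert_dot a b i j k : triangle_params (a, b) -> uniq [:: i; j; k] ->
  let e := psub (vert a b j) (vert a b i) in
  let f := psub (vert a b k) (vert a b i) in
  pdot f e / pdot e e = sin (ang a b j) * cos (ang a b i) / sin (ang a b k).
Proof.
move=> hab u.
have h2 : a + b + (pi - a - b) = pi by ring.
have Es : sin (pi - a - b) = sin (a + b) by rewrite (sin_sum_pi h2) sinD.
have Ec := cos_sum_pi h2.
have := ang_sin_gt0 (inord 0) hab; have := ang_sin_gt0 (inord 1) hab.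
have := ang_sin_gt0 (inord 2) hab; rewrite !angE Es.
move: i j k u; apply: ord3_distinct; rewrite !vertE !angE /psub /pdot /= ?Es ?Ec;
  move: (cos2sin2E a) (cos2sin2E b) (sinD a b).
all: set S := sin (a + b); set sa := sin a; set sb := sin b; set ca := cos a; set cb := cos b.
all: move=> ea eb ES S0 sb0 sa0; have nS := lt0r_neq0 S0; have na := lt0r_neq0 sa0;
  have nb := lt0r_neq0 sb0.
(* All six cases reduce to the squared lengths [F0] and [F1] of two sides and the scalar product
   [F2]. *)
all: set X := sb * ca / S; set Y := sb * sa / S.
all: have F0 : X * X + Y * Y = sb * sb / (S * S);
  first by (transitivity (sb * sb * (ca * ca + sa * sa) / (S * S));
    [rewrite /X /Y; field | rewrite ea; field]).
all: have XS : 1 - X = sa * cb / S;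
  first by (transitivity ((S - ca * sb) / S); [rewrite /X; field | rewrite {1}ES; field]).
all: have F1 : (1 - X) * (1 - X) + Y * Y = sa * sa / (S * S);
  first by (rewrite XS; transitivity (sa * sa * (cb * cb + sb * sb) / (S * S));
    [rewrite /Y; field | rewrite eb; field]).
all: have F2 : X * X + Y * Y - X = sa * sb * (sa * sb - ca * cb) / (S * S);
  first by (rewrite F0; transitivity ((sb * sb - sb * ca * S) / (S * S));
    [rewrite /X; field | rewrite {1}ES; transitivity
      ((sb * sb * (1 - ca * ca) - sb * ca * (sa * cb)) / (S * S)); [by field | rewrite ea; field]]).
- by rewrite /X; field.
- have -> : (X - 1) * (X - 1) + (Y - 0) * (Y - 0) = sa * sa / (S * S) by rewrite -F1; ring.
  have -> : (0 - 1) * (X - 1) + (0 - 0) * (Y - 0) = sa * cb / S by rewrite -XS; ring.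
  by field; rewrite nS na.
- have -> : (0 - X) * (0 - X) + (0 - Y) * (0 - Y) = sb * sb / (S * S) by rewrite -F0; ring.
  have -> : (1 - X) * (0 - X) + (0 - Y) * (0 - Y) = sa * sb * (sa * sb - ca * cb) / (S * S).
    by rewrite -F2; ring.
  by field; rewrite nS nb.
- have -> : (X - 1) * (0 - 1) + (Y - 0) * (0 - 0) = sa * cb / S by rewrite -XS; ring.
  by field; rewrite nS.
- have -> : (1 - X) * (1 - X) + (0 - Y) * (0 - Y) = sa * sa / (S * S) by rewrite -F1; ring.
  have -> : (0 - X) * (1 - X) + (0 - Y) * (0 - Y) = sa * sb * (sa * sb - ca * cb) / (S * S).
    by rewrite -F2; ring.
  by field; rewrite nS na.
- have -> : (X - 0) * (X - 0) + (Y - 0) * (Y - 0) = sb * sb / (S * S) by rewrite -F0; ring.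
  by rewrite !(mulr0, mulr1, subr0, addr0, mul1r) /X; field; rewrite nS nb.
Qed.


Lemma vert_cross a b i j k : triangle_params (a, b) -> uniq [:: i; j; k] ->
  cross (psub (vert a b j) (vert a b i)) (psub (vert a b k) (vert a b i)) != 0.
Proof.
move=> hab.
have := ang_sin_gt0 (inord 0) hab; have := ang_sin_gt0 (inord 1) hab.
have := ang_sin_gt0 (inord 2) hab; rewrite !angE.
have h2 : a + b + (pi - a - b) = pi by ring.
have -> : sin (pi - a - b) = sin (a + b) by rewrite (sin_sum_pi h2) sinD.
move=> S0 sb0 sa0 u; set y := sin b * sin a / sin (a + b).
suff : cross (psub (vert a b j) (vert a b i)) (psub (vert a b k) (vert a b i)) = y \/
    cross (psub (vert a b j) (vert a b i)) (psub (vert a b k) (vert a b i)) = - y.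
  by case=> ->; rewrite ?oppr_eq0 !mulf_neq0 ?invr_eq0 ?lt0r_neq0.
by move: i j k u; apply: ord3_distinct; rewrite !vertE /psub /cross /= -/y;
  [left|left|left|right|right|right]; ring.
Qed.

Lemma side_dirE a b i j k : uniq [:: i; j; k] ->
  side_dir a b k = psub (vert a b j) (vert a b i) \/
  side_dir a b k = psub (vert a b i) (vert a b j).
Proof.
by move: i j k; apply: ord3_distinct; rewrite /side_dir /side_end1 /side_end2 /= !inordK;
  try (by []); (by left) || (by right).
Qed.

Lemma on_open_sideP a b i j k p : uniq [:: i; j; k] -> on_open_side a b k p ->
  exists2 t, 0 < t < 1 &
    p = padd (pscale (1 - t) (vert a b i)) (pscale t (vert a b j)).
Proof.
move=> u [t t01 ->].
have [|] : side_end1 k = i /\ side_end2 k = j \/ side_end1 k = j /\ side_end2 k = i.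
- by move: i j k u; apply: ord3_distinct; rewrite /side_end1 /side_end2 /= !inordK;
    try (by []); (by left) || (by right).
- by case=> -> ->; exists t.
- case=> -> ->; exists (1 - t); first by lra.
  by rewrite /padd /pscale /=; congr (_, _); ring.
Qed.

Lemma reflect_comb (u e f : pt) (x y : R) :
  Defs.reflect u (padd (pscale x e) (pscale y f)) =
  padd (pscale x (Defs.reflect u e)) (pscale y (Defs.reflect u f)).
Proof. by rewrite /Defs.reflect /padd /pscale /psub /pdot /=; congr (_, _); ring. Qed.

Lemma reflect_opp (e f d : pt) : Defs.reflect (psub e f) d = Defs.reflect (psub f e) d.
Proof.
rewrite /Defs.reflect.
have -> : pdot (psub e f) (psub e f) = pdot (psub f e) (psub f e).
  by rewrite /pdot /psub /=; ring.
by rewrite /pscale /psub /pdot /=; congr (_, _); ring.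
Qed.

Variables a b : R.
Hypothesis hab : triangle_params (a, b).
Notation vt := (vert a b).
Notation th := (ang a b).

(* Linear part of the affine map sending the vertices [vt i] to [P i]. *)
Definition lin (P : 'I_3 -> pt) (d : pt) : pt :=
  let m := d.2 / (vt (inord 2)).2 in
  padd (pscale (d.1 - m * (vt (inord 2)).1) (psub (P (inord 1)) (P (inord 0))))
       (pscale m (psub (P (inord 2)) (P (inord 0)))).

Definition aff (P : 'I_3 -> pt) (p : pt) : pt := padd (P (inord 0)) (lin P p).

Lemma apex_neq0 : (vt (inord 2)).2 != 0.
Proof.
have u : uniq [:: inord 0; inord 1; inord 2 : 'I_3].
  by rewrite /= !inE -!val_eqE /= !inordK.
have := vert_cross hab u; rewrite !vertE /cross /psub /=.
by rewrite !(subr0, mul1r, mul0r).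
Qed.

Lemma lin_comb P x y d e :
  lin P (padd (pscale x d) (pscale y e)) = padd (pscale x (lin P d)) (pscale y (lin P e)).
Proof. by rewrite /lin /padd /pscale /psub /=; congr (_, _); ring. Qed.

Lemma aff_sub P p q : lin P (psub p q) = psub (aff P p) (aff P q).
Proof. by rewrite /aff /lin /padd /pscale /psub /=; congr (_, _); ring. Qed.

Lemma aff_vert P i : aff P (vt i) = P i.
Proof.
have y0 := apex_neq0.
move: i; apply: ord3P; apply: pt_eq; rewrite /aff /lin /padd /pscale /psub /= ?vert0 ?vert1 /=;
  by field.
Qed.

Lemma aff_comb P t p q : aff P (padd (pscale (1 - t) p) (pscale t q)) =
  padd (pscale (1 - t) (aff P p)) (pscale t (aff P q)).
Proof. by rewrite /aff /lin /padd /pscale /psub /=; congr (_, _); ring. Qed.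

Lemma ang_sin_neq0 i : sin (th i) != 0.
Proof. exact: lt0r_neq0 (ang_sin_gt0 i hab). Qed.

(* The reflection of [P k] in the line through [P i] and [P j], when [P] is a similar copy
   of the triangle. *)
Definition mirror (P : 'I_3 -> pt) i j k : pt :=
  psub (pscale 2 (padd (P i) (pscale (sin (th j) * cos (th i) / sin (th k)) (psub (P j) (P i)))))
       (P k).

(** Unfolding principle: instead of reflecting the direction one reflects the triangle. It suffices
    to check two edge vectors, the side [e] fixed by the reflection and another edge [f]. *)
Lemma lin_reflect (P P' : 'I_3 -> pt) i j k d : uniq [:: i; j; k] ->
  P' i = P i -> P' j = P j -> P' k = mirror P i j k ->
  lin P' (Defs.reflect (side_dir a b k) d) = lin P d.
Proof.
move=> u Pi Pj Pk.
have -> : Defs.reflect (side_dir a b k) d = Defs.reflect (psub (vt j) (vt i)) d.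
  by case: (side_dirE a b u) => -> //; rewrite reflect_opp.
have := vert_dot hab u; have := vert_cross hab u; rewrite /=.
have Le Q : lin Q (psub (vt j) (vt i)) = psub (Q j) (Q i) by rewrite aff_sub !aff_vert.
have Lf Q : lin Q (psub (vt k) (vt i)) = psub (Q k) (Q i) by rewrite aff_sub !aff_vert.
move: Le Lf; move: (psub (vt j) (vt i)) (psub (vt k) (vt i)) => e f Le Lf ef Ed.
(* Cramer's rule in the basis [e], [f]. *)
have -> : d = padd (pscale (cross d f / cross e f) e) (pscale (cross e d / cross e f) f).
  by apply: pt_eq; rewrite /padd /pscale /=; move: ef; rewrite /cross => ef; field.
have ee : pdot e e != 0.
  apply: contraNneq ef; rewrite /pdot => /eqP; rewrite paddr_eq0 ?sqr_ge0 // -?expr2 ?sqr_ge0 //.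
  by rewrite !sqrf_eq0 /cross => /andP[/eqP-> /eqP->]; rewrite !mul0r subrr.
have Re : Defs.reflect e e = padd (pscale 1 e) (pscale 0 f).
  apply: pt_eq; rewrite /Defs.reflect /psub /pscale /padd /= mulfK //; ring.
have Rf : Defs.reflect e f =
    padd (pscale (2 * (sin (th j) * cos (th i) / sin (th k))) e) (pscale (-1) f).
  by apply: pt_eq; rewrite /Defs.reflect -mulrA Ed /psub /pscale /padd /=; ring.
rewrite reflect_comb Re Rf !lin_comb !Le !Lf Pi Pj Pk /mirror.
by apply: pt_eq; rewrite /psub /pscale /padd /=; ring.
Qed.

(* An unfolded copy of the triangle, rescaled so that the side opposite vertex [i] has length
   [sin (th i)], and crossed through the edge with right endpoint [lR] at [pos] and left endpoint
   [lL] in direction [phase]; [lV] labels the vertex beyond that edge. *)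
Record state := State { lR : 'I_3; lL : 'I_3; lV : 'I_3; pos : pt; phase : R }.

Definition pL s := padd (pos s) (pscale (sin (th (lV s))) (cis (phase s))).
Definition pV s := padd (pos s) (pscale (sin (th (lL s))) (cis (phase s - th (lR s)))).

Definition step c s :=
  if c then State (lV s) (lL s) (lR s) (pV s) (phase s + th (lL s))
  else State (lR s) (lV s) (lL s) (pos s) (phase s - th (lR s)).

Definition labels s := [:: lR s; lL s; lV s].

Definition placed s i := if i == lR s then pos s else if i == lL s then pL s else pV s.

Lemma labels_step c s : uniq (labels s) -> uniq (labels (step c s)).
Proof.
rewrite /labels /step; case: c; case: s => x y z p f; rewrite /= !inE !andbT !negb_or.
  by rewrite (eq_sym z y) (eq_sym z x) (eq_sym y x) andbC => /andP[-> /andP[-> ->]].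
by rewrite (eq_sym z y) => /andP[/andP[-> ->] ->].
Qed.

Lemma placed_labels s : uniq (labels s) ->
  [/\ placed s (lR s) = pos s, placed s (lL s) = pL s & placed s (lV s) = pV s].
Proof.
rewrite /labels /= !inE !andbT => /andP[]; rewrite negb_or => /andP[n1 n2] n3.
by rewrite /placed !eqxx !(eq_sym (lL s) (lR s)) (eq_sym (lV s)) (negbTE n1) (negbTE n2)
  (eq_sym (lV s)) (negbTE n3).
Qed.

Lemma labels_sum s : uniq (labels s) -> th (lR s) + th (lL s) + th (lV s) = pi.
Proof. exact: ang_sum. Qed.

(** For [true] the triangle closes up at its left endpoint because its angles sum to [pi]; for
    [false] this is the definition of [pV]. *)
Lemma pL_step c s : uniq (labels s) -> pL (step c s) = if c then pL s else pV s.
Proof.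
move=> /labels_sum h; case: c => //; rewrite /pL /pV /step /=.
have Es := sin_sum_pi h; apply: pt_eq; rewrite /padd /pscale /cis /=.
  by rewrite Es cosB cosD; ring.
by rewrite Es sinB sinD; ring.
Qed.

(** This identifies [step] with unfolding across the exit edge, as [lin_reflect] requires. *)
Lemma step_reflect c s : uniq (labels s) -> let s' := step c s in
  [/\ placed s' (lR s') = placed s (lR s'), placed s' (lL s') = placed s (lL s') &
      placed s' (lV s') = mirror (placed s) (lR s') (lL s') (lV s')].
Proof.
move=> u s'; have u' : uniq (labels s') by exact: labels_step.
have [PR PL PV] := placed_labels u; have [PR' PL' PV'] := placed_labels u'.
rewrite PR' PL' PV' (pL_step c u) /mirror.
have Ek : placed s (lR s') = pos s' by rewrite /s'; case: (c).
have El : placed s (lL s') = if c then pL s else pV s by rewrite /s'; case: (c).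
rewrite Ek El; split=> //.
have nR := ang_sin_neq0 (lR s); have nL := ang_sin_neq0 (lL s).
rewrite /s'; case: c {s' u' PR' PL' PV' Ek El} => /=; rewrite ?PR ?PL.
  have -> : psub (pL s) (pV s) = pscale (sin (th (lR s))) (cis (phase s + th (lL s))).
    by rewrite -(pL_step true u) /pL /=; apply: pt_eq; rewrite /psub /padd /=; ring.
  have E : phase s - th (lR s) = phase s + th (lL s) + th (lV s) - pi.
    by rewrite -(labels_sum u); ring.
  rewrite /pV /= {}E; move: (phase s + th (lL s)) => psi.
  have Ec : cos (psi + th (lV s) - pi) = - cos (psi + th (lV s)).
    by rewrite cosB cospi sinpi; ring.
  have Es : sin (psi + th (lV s) - pi) = - sin (psi + th (lV s)).
    by rewrite sinB cospi sinpi; ring.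
  by apply: pt_eq; rewrite /cis /psub /padd /pscale /= ?Ec ?Es ?cosB ?sinB ?cosD ?sinD; field.
have -> : psub (pV s) (pos s) = pscale (sin (th (lL s))) (cis (phase s - th (lR s))).
  by rewrite /pV; apply: pt_eq; rewrite /psub /padd /=; ring.
rewrite /pV /pL /=.
have -> : cis (phase s) = cis ((phase s - th (lR s)) + th (lR s)) by congr cis; ring.
move: (phase s - th (lR s)) => psi.
by apply: pt_eq; rewrite /cis /psub /padd /pscale /= ?cosB ?sinB ?cosD ?sinD; field.
Qed.

(* Coordinates are chosen with the vertex [v] at the origin. *)
Definition root v : state :=
  State (side_end1 v) (side_end2 v) v
    (pscale (- sin (th (side_end2 v))) (cis (th (side_end1 v)))) 0.

Definition unfold v w := foldr step (root v) w.

Lemma labels_root v : uniq (labels (root v)).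
Proof.
rewrite /labels /=; move: v; apply: ord3P;
  by rewrite /side_end1 /side_end2 /= !inE -!val_eqE /= !inordK.
Qed.

Lemma labels_unfold v w : uniq (labels (unfold v w)).
Proof. by elim: w => [|c w IH]; [exact: labels_root | exact: labels_step]. Qed.

Definition rtw v w := pos (unfold v w).
Definition lfw v w := pL (unfold v w).
Definition apw v w := pV (unfold v w).

Lemma rtwS v c w : rtw v (c :: w) = if c then apw v w else rtw v w.
Proof. by rewrite /rtw /apw /=; case: c. Qed.

Lemma lfwS v c w : lfw v (c :: w) = if c then lfw v w else apw v w.
Proof. by rewrite /lfw /apw /= pL_step //; exact: labels_unfold. Qed.

(** The difference of the two sides is twice the area of the copy, a product of three sines. *)
Lemma apw_beyond v w :
  cross (rtw v w) (lfw v w) < cross (apw v w) (lfw v w) + cross (rtw v w) (apw v w).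
Proof.
rewrite /rtw /lfw /apw; set s := unfold v w; rewrite -subr_gt0.
have := mulr_gt0 (ang_sin_gt0 (lR s) hab)
  (mulr_gt0 (ang_sin_gt0 (lL s) hab) (ang_sin_gt0 (lV s) hab)).
suff -> : cross (pV s) (pL s) + cross (pos s) (pV s) - cross (pos s) (pL s) =
  sin (th (lR s)) * (sin (th (lL s)) * sin (th (lV s))) by [].
rewrite /pV /pL /cross /padd /pscale /cis /= cosB sinB.
transitivity (sin (th (lR s)) * (sin (th (lL s)) * sin (th (lV s))) *
  (cos (phase s) * cos (phase s) + sin (phase s) * sin (phase s))); first by ring.
by rewrite cos2sin2E; ring.
Qed.

Lemma root_cross_gt0 v : 0 < cross (rtw v [::]) (lfw v [::]).
Proof.
have := mulr_gt0 (ang_sin_gt0 (side_end1 v) hab)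
  (mulr_gt0 (ang_sin_gt0 (side_end2 v) hab) (ang_sin_gt0 v hab)).
rewrite /rtw /lfw /pL /= /cross /padd /pscale /cis /= cos0 sin0.
by congr (0 < _); ring.
Qed.

(** The base point starts at norm at most 1, and each turn, like the final passage to the apex,
    moves it by a vector of norm at most 1. *)
Lemma apw_norm v w : `|(apw v w).1| <= (size w).+2%:R /\ `|(apw v w).2| <= (size w).+2%:R.
Proof.
have sc (x y : R) : `|sin x * cos y| <= 1.
  by rewrite normrM mulr_ile1 // ?sin_max ?cos_max.
have ss (x y : R) : `|sin x * sin y| <= 1 by rewrite normrM mulr_ile1 // ?sin_max.
have pos_le : `|(pos (unfold v w)).1| <= (size w).+1%:R /\
              `|(pos (unfold v w)).2| <= (size w).+1%:R.
  elim: w => [|c w [IH1 IH2]].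
    by rewrite /= !mulNr !normrN.
  have le n : n.+1%:R <= n.+2%:R :> R by rewrite ler_nat.
  case: c; last by split; apply: le_trans (le _).
  by rewrite /= /pV /=; split; rewrite -natr1 (le_trans (ler_normD _ _)) // lerD.
by case: pos_le => h1 h2; rewrite /apw /pV /=; split;
  rewrite -natr1 (le_trans (ler_normD _ _)) // lerD.
Qed.

(** Barycentric coordinate relative to vertex [k]: zero on the opposite side, positive inside the
    triangle. *)
Definition bary k p : R := (aff (fun i => if i == k then (1, 0) else (0, 0)) p).1.

Lemma bary_vert k i : bary k (vt i) = (i == k)%:R.
Proof. by rewrite /bary aff_vert; case: eqP. Qed.

Lemma bary_mid k p q : bary k (pscale 2^-1 (padd p q)) = 2^-1 * (bary k p + bary k q).
Proof.
have y0 := apex_neq0; by rewrite /bary /aff /lin /padd /pscale /psub /=; field; rewrite ?y0.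
Qed.

Lemma bary_comb k t p q : bary k (padd (pscale (1 - t) p) (pscale t q)) =
  (1 - t) * bary k p + t * bary k q.
Proof. by rewrite /bary aff_comb. Qed.

Lemma bary_interior k p : in_open_triangle a b p -> 0 < bary k p.
Proof.
move=> [l0 [l1 [l2 [p0 p1 p2 s1 ->]]]].
have -> : bary k (padd (pscale l0 (vt 0)) (padd (pscale l1 (vt 1)) (pscale l2 (vt 2)))) =
    l0 * bary k (vt 0) + l1 * bary k (vt 1) + l2 * bary k (vt 2).
  have E1 : l0 = 1 - l1 - l2 by rewrite -s1; ring.
  by rewrite E1 /bary /aff /lin /padd /pscale /psub /=; ring.
have -> : (2 : 'I_3) = inord 2 by apply/val_inj; rewrite /= inordK.
have -> : (0 : 'I_3) = inord 0 by apply/val_inj; rewrite /= inordK.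
have -> : (1 : 'I_3) = inord 1 by apply/val_inj; rewrite /= inordK.
have ne m n : (m < 3)%N -> (n < 3)%N -> ((inord m : 'I_3) == inord n) = (m == n).
  by move=> ? ?; rewrite -val_eqE /= !inordK.
by rewrite !bary_vert; move: k; apply: ord3P;
  rewrite !ne //= !(mulr0, mulr1, addr0, add0r).
Qed.

Lemma bary_side k p : on_open_side a b k p -> bary k p = 0.
Proof.
case=> t _ ->; rewrite bary_comb !bary_vert.
have [-> ->] : (side_end1 k == k) = false /\ (side_end2 k == k) = false.
  by move: k; apply: ord3P; rewrite /side_end1 /side_end2 -!val_eqE /= !inordK.
by rewrite !mulr0 addr0.
Qed.

Definition cone v := incone (rtw v) (lfw v) (apw v).
Definition uray v := ray (rtw v) (lfw v).

(** The point where the ray crosses the edge of [w], folded back to the original triangle by keeping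
    its ratio on the side with the same labels. *)
Definition crossing v l w : pt :=
  let s := unfold v w in
  let t := cross (pos s) (uray v l) / (cross (pos s) (uray v l) + cross (uray v l) (pL s)) in
  padd (pscale (1 - t) (vt (lR s))) (pscale t (vt (lL s))).

Fixpoint crossings v l w : seq pt :=
  if w is _ :: w' then rcons (crossings v l w') (crossing v l w) else [:: crossing v l w].

Lemma last_crossings p v l w : last p (crossings v l w) = crossing v l w.
Proof. by case: w => //= c w; rewrite last_rcons. Qed.

(** The ratio [t] is unique because the endpoints of the edge lie strictly on opposite sides of the
    ray. *)
Lemma crossing_fold v l w t p : cone v l w ->
  padd (pscale (1 - t) (rtw v w)) (pscale t (lfw v w)) = pscale p (uray v l) ->
  crossing v l w = padd (pscale (1 - t) (vt (lR (unfold v w)))) (pscale t (vt (lL (unfold v w)))).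
Proof.
move=> hc E.
have [rd dl _] := cone_edge (rtwS v) (lfwS v) (apw_beyond v) (root_cross_gt0 v) hc.
have : cross (padd (pscale (1 - t) (rtw v w)) (pscale t (lfw v w))) (uray v l) = 0.
  by rewrite E /cross /pscale /=; ring.
have -> : cross (padd (pscale (1 - t) (rtw v w)) (pscale t (lfw v w))) (uray v l) =
  (1 - t) * cross (rtw v w) (uray v l) - t * cross (uray v l) (lfw v w).
  by rewrite /cross /padd /pscale /=; ring.
move=> E0; rewrite /crossing -/(rtw v w) -/(lfw v w).
move: rd dl; rewrite -/(uray v l) => rd dl.
suff -> : cross (rtw v w) (uray v l) /
  (cross (rtw v w) (uray v l) + cross (uray v l) (lfw v w)) = t by [].
apply: (canLR (mulfK (lt0r_neq0 (addr_gt0 rd dl)))).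
by apply/eqP; rewrite -subr_eq0; apply/eqP; rewrite -[RHS]E0; ring.
Qed.

(** Inductive step for directions: seen in the reflected copy, the orbit after a bounce continues
    along [d]. *)
Lemma reflect_scale s' (P : 'I_3 -> pt) (p q r d : pt) (x : R) : uniq (labels s') ->
  placed s' (lR s') = P (lR s') -> placed s' (lL s') = P (lL s') ->
  placed s' (lV s') = mirror P (lR s') (lL s') (lV s') ->
  0 < x -> lin P (psub q p) = pscale x d ->
  (exists2 t, 0 < t & psub r q = pscale t (Defs.reflect (side_dir a b (lV s')) (psub q p))) ->
  exists2 y, 0 < y & lin (placed s') (psub r q) = pscale y d.
Proof.
move=> u PR PL PV x0 Ex [t t0 ->]; exists (t * x); first exact: mulr_gt0.
have -> : lin (placed s') (pscale t (Defs.reflect (side_dir a b (lV s')) (psub q p))) =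
    pscale t (lin (placed s') (Defs.reflect (side_dir a b (lV s')) (psub q p))).
  by rewrite /lin /pscale /padd /psub /=; congr (_, _); ring.
by rewrite (lin_reflect _ u PR PL PV) Ex /pscale /= !mulrA.
Qed.

Lemma aff_crossing v l w : cone v l w ->
  exists x, aff (placed (unfold v w)) (crossing v l w) = pscale x (uray v l).
Proof.
move=> hc; have [PR PL _] := placed_labels (labels_unfold v w).
have [rd dl _] := cone_edge (rtwS v) (lfwS v) (apw_beyond v) (root_cross_gt0 v) hc.
rewrite /crossing aff_comb !aff_vert PR PL -/(rtw v w) -/(lfw v w).
move: rd dl; rewrite -/(uray v l); move: (uray v l) => d rd dl.
exists (cross (rtw v w) (lfw v w) / (cross (rtw v w) d + cross d (lfw v w))).
have := lt0r_neq0 (addr_gt0 rd dl); rewrite /cross => n0.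
by apply: pt_eq; rewrite /padd /pscale /=; field.
Qed.

Lemma bary_crossing v l w : bary (lV (unfold v w)) (crossing v l w) = 0.
Proof.
have := labels_unfold v w; rewrite /crossing bary_comb !bary_vert /labels /= !inE !andbT.
rewrite negb_or => /andP[/andP[_ n1] n2].
by rewrite (negbTE n1) (negbTE n2) !mulr0 addr0.
Qed.

(** The copy is entered through the side opposite [lV s]; each of the other two sides is the exit of
    one turn. *)
Lemma label_step_cases i s : uniq (labels s) -> i != lV s -> exists c, i = lV (step c s).
Proof.
move=> u; have : i \in labels s.
  have /subset_cardP : #|labels s| = #|'I_3| by rewrite (card_uniqP u) card_ord.
  by move=> /(_ (subset_predT _)) ->.
rewrite !inE => /orP[/eqP->|/orP[/eqP->|/eqP->]]; last by rewrite eqxx.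
- by exists true.
- by exists false.
Qed.

(** * Following a generalized diagonal through the unfolding *)

Section Track.
Variables (v wv : 'I_3) (s : seq pt).
Hypothesis gd : gen_diag a b v s wv.
Let pts := vt v :: rcons s (vt wv).
Let q (i : nat) := nth (0, 0) pts i.

Lemma gd_on_side (i : nat) : (i < size s)%N -> exists j, on_open_side a b j (q i.+1).
Proof.
move=> si; case: gd => h _ _; apply: h.
by rewrite /q /pts /= nth_rcons si mem_nth.
Qed.

(** The midpoint condition prevents two consecutive points from lying on the line of one side. *)
Lemma gd_mid k (i : nat) : (i <= size s)%N -> 0 < bary k (q i) + bary k (q i.+1).
Proof.
move=> si; case: gd => _ h _; have := bary_interior k (h i si).
by rewrite bary_mid pmulr_rgt0 // invr_gt0.
Qed.

Lemma gd_reflect (i : nat) j : (i < size s)%N -> on_open_side a b j (q i.+1) -> exists2 t, 0 < t &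
  psub (q i.+2) (q i.+1) = pscale t (Defs.reflect (side_dir a b j) (psub (q i.+1) (q i))).
Proof. by move=> si hj; case: gd => _ _ h; exact: h. Qed.

Lemma gd_pts (i : nat) : (i < size s)%N -> q i.+1 = nth (0, 0) s i.
Proof. by move=> si; rewrite /q /pts /= nth_rcons si. Qed.

(** Without reflections the path would stay on the side opposite some third vertex [k]. *)
Lemma gd_size : (0 < size s)%N.
Proof.
rewrite lt0n size_eq0; apply/eqP => s0.
have [k kv kw] : exists2 k, v != k & wv != k.
  move: v wv; apply: ord3P; apply: ord3P;
    [exists (inord 1)|exists (inord 2)|exists (inord 1)|exists (inord 2)|exists (inord 0)
    |exists (inord 0)|exists (inord 1)|exists (inord 0)|exists (inord 0)];
    by rewrite -val_eqE /= !inordK.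
have := @gd_mid k 0%N (leq0n _); rewrite /q /pts s0 /= !bary_vert (negbTE kv) (negbTE kw).
by rewrite addr0 ltxx.
Qed.

Lemma gd_first : exists2 l, 0 < l < 1 & q 1%N = crossing v l [::] /\
  exists2 x, 0 < x & lin (placed (root v)) (psub (q 2%N) (q 1%N)) = pscale x (uray v l).
Proof.
have [j hj] := gd_on_side gd_size.
have jv : j = v.
  apply/eqP; apply: contraT => ne; have := @gd_mid j 0%N (leq0n _).
  by rewrite (bary_side hj) /q /= bary_vert eq_sym (negbTE ne) addr0 ltxx.
rewrite {j}jv in hj; have [t t01 Et] := on_open_sideP (labels_root v) hj.
exists t => //.
have E : crossing v t [::] = q 1%N.
  rewrite Et; apply: (@crossing_fold v t [::] t 1) => //.
  by rewrite /pscale /uray /ray /padd /rtw /lfw /=; congr (_, _); rewrite mul1r.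
split=> //.
(* The triangle itself, placed with [v] at the origin; [root v] is its mirror image in the side
   opposite [v]. *)
pose P i : pt := if i == lR (root v) then pos (root v) else
  if i == lL (root v) then pL (root v) else (0, 0).
have u := labels_root v; have [PR PL PV] := placed_labels u.
have := u; rewrite /labels [uniq _]/= !inE !andbT negb_or => /andP[/andP[n1 n2] n3].
have EV : P v = (0, 0) by rewrite /P (eq_sym v) (negbTE n2) (eq_sym v) (negbTE n3).
have ER : P (lR (root v)) = pos (root v) by rewrite /P eqxx.
have EL : P (lL (root v)) = pL (root v) by rewrite /P eq_sym (negbTE n1) eqxx.
apply: (@reflect_scale (root v) P (q 0%N) _ _ _ 1 u).
- by rewrite PR ER.
- by rewrite PL EL.
- rewrite PV /mirror ER EL EV /pL /pV /=; have nv := ang_sin_neq0 v.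
  apply: pt_eq; rewrite /padd /psub /pscale /cis /= ?cosB ?sinB cos0 sin0;
    by field.
- exact: ltr01.
- rewrite aff_sub Et aff_comb !aff_vert EV.
  rewrite -/(lR (root v)) -/(lL (root v)) ER EL.
  by rewrite /uray /ray /rtw /lfw /psub /padd /pscale /=; congr (_, _); ring.
- exact: gd_reflect gd_size hj.
Qed.

(** Induction along the orbit: each new side hit names the next turn, and by [reflect_scale] the
    unfolded path stays on one ray. *)
Lemma gd_track (i : nat) : (i < size s)%N -> exists l w,
  [/\ size w = i, cone v l w, take i.+1 s = crossings v l w &
  exists2 x, 0 < x & lin (placed (unfold v w)) (psub (q i.+2) (q i.+1)) = pscale x (uray v l)].
Proof.
elim: i => [|i IH] si.
  have [l l01 [Eq [x x0 Ex]]] := gd_first; exists l, [::]; split=> //; last by exists x.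
  rewrite /= -Eq gd_pts //; move: si; case: (s) => //= p s' _.
  by rewrite take0.
have [l [w [sw hc ts [x x0 Ex]]]] := IH (ltnW si).
have [j hj] := gd_on_side si; set st := unfold v w in Ex *.
have u : uniq (labels st) := labels_unfold v w.
have qi : q i.+1 = crossing v l w.
  rewrite gd_pts 1?ltnW // -(last_crossings (0, 0) v l w) -ts (last_nth (0, 0)) size_take.
  by rewrite si /= nth_take.
have jV : j != lV st.
  apply/eqP => jE; have := @gd_mid j i.+1 (ltnW si).
  by rewrite (bary_side hj) qi jE bary_crossing addr0 ltxx.
have [c jc] := label_step_cases u jV; rewrite {j jV}jc in hj.
have u' := labels_step c u; have [ER EL EV] := step_reflect c u.
have [PR PL _] := placed_labels u'.
have [t /andP[t0 t1] Et] := on_open_sideP u' hj.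
have [y Ey] := aff_crossing hc.
(* Unfolded, the next bounce point is still on the ray, at scale [y + x]. *)
have Eq2 : aff (placed st) (q i.+2) = pscale (y + x) (uray v l).
  have -> : aff (placed st) (q i.+2) =
      padd (aff (placed st) (q i.+1)) (lin (placed st) (psub (q i.+2) (q i.+1))).
    by rewrite aff_sub /padd /psub /=; apply: pt_eq => /=; ring.
  by rewrite Ex qi Ey /padd /pscale /=; congr (_, _); ring.
have Eq3 : padd (pscale (1 - t) (rtw v (c :: w))) (pscale t (lfw v (c :: w))) =
    pscale (y + x) (uray v l).
  by rewrite -Eq2 Et aff_comb !aff_vert -ER -EL PR PL.
have [rd dl _] := cone_edge (rtwS v) (lfwS v) (apw_beyond v) (root_cross_gt0 v) hc.
have t1' : 0 < 1 - t by rewrite subr_gt0.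
(* The ray meets the new edge strictly inside; one endpoint is an old one whose side is known, so
   the apex is on the other side. *)
have hc' : cone v l (c :: w).
  rewrite /cone /= -/(cone v l w) hc /=.
  have : cross (padd (pscale (1 - t) (rtw v (c :: w))) (pscale t (lfw v (c :: w))))
      (uray v l) = 0 by rewrite Eq3 /cross /pscale /=; ring.
  have -> : cross (padd (pscale (1 - t) (rtw v (c :: w))) (pscale t (lfw v (c :: w))))
      (uray v l) = (1 - t) * cross (rtw v (c :: w)) (uray v l)
                   - t * cross (uray v l) (lfw v (c :: w)).
    by rewrite /cross /padd /pscale /=; ring.
  rewrite rtwS lfwS; move: rd dl; rewrite -/(uray v l); case: (c) => rd dl E0 /=.
    have : 0 < (1 - t) * cross (apw v w) (uray v l).
      by have := mulr_gt0 t0 dl; lra.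
    by rewrite (pmulr_rgt0 _ t1') mul1r.
  have : 0 < t * cross (uray v l) (apw v w).
    by have := mulr_gt0 t1' rd; lra.
  rewrite (pmulr_rgt0 _ t0) mulN1r => h.
  suff -> : - cross (apw v w) (uray v l) = cross (uray v l) (apw v w) by [].
  by rewrite /cross; ring.
have Ec : crossing v l (c :: w) = q i.+2 by rewrite Et; exact: crossing_fold hc' Eq3.
exists l, (c :: w); split=> //=; first by rewrite sw.
  by rewrite (take_nth (0, 0)) // ts Ec gd_pts.
by apply: (reflect_scale u' ER EL EV x0 Ex); exact: gd_reflect si hj.
Qed.

(** The word is one letter shorter than the number of reflections, since [root v] already lies
    beyond the first one. *)
Lemma gd_word : exists l w, [/\ size s = (size w).+1, hits (rtw v) (lfw v) (apw v) w l,
  s = crossings v l w & wv = lV (unfold v w)].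
Proof.
have s0 := gd_size; have lt : ((size s).-1 < size s)%N by rewrite prednK.
have [l [w [sw hc ts [x x0 Ex]]]] := gd_track lt; exists l, w.
rewrite prednK // take_size in ts.
have Es : size s = (size w).+1 by rewrite sw prednK.
have [y Ey] := aff_crossing hc.
have qi : q (size s) = crossing v l w.
  by rewrite -(prednK s0) gd_pts // -(last_crossings (0, 0) v l w) -ts (last_nth (0, 0))
     -{2}(prednK s0).
rewrite prednK // qi in Ex.
have qe : q (size s).+1 = vt wv by rewrite /q /pts /= nth_rcons ltnn eqxx.
have Ew : placed (unfold v w) wv = pscale (y + x) (uray v l).
  rewrite -aff_vert -qe.
  have -> : aff (placed (unfold v w)) (q (size s).+1) =
      padd (aff (placed (unfold v w)) (crossing v l w))
           (lin (placed (unfold v w)) (psub (q (size s).+1) (crossing v l w))).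
    by rewrite aff_sub /padd /psub /=; apply: pt_eq => /=; ring.
  by rewrite Ex Ey /padd /pscale /=; congr (_, _); ring.
have u := labels_unfold v w; have [PR PL PV] := placed_labels u.
have [rd dl _] := cone_edge (rtwS v) (lfwS v) (apw_beyond v) (root_cross_gt0 v) hc.
have par : cross (placed (unfold v w) wv) (uray v l) = 0.
  by rewrite Ew /cross /pscale /=; ring.
have wE : wv = lV (unfold v w).
  have : wv \in labels (unfold v w).
    have /subset_cardP : #|labels (unfold v w)| = #|'I_3| by rewrite (card_uniqP u) card_ord.
    by move=> /(_ (subset_predT _)) ->.
  (* The endpoints of the last edge are strictly off the ray, so only the apex can be the final
     vertex. *)
  rewrite !inE => /orP[/eqP E|/orP[/eqP E|/eqP //]]; exfalso; move: par; rewrite E.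
    by rewrite PR => e0; move: rd; rewrite -/(uray v l) /rtw e0 ltxx.
  rewrite PL => e0; move: dl; rewrite -/(uray v l) /lfw.
  have -> : cross (uray v l) (pL (unfold v w)) = - cross (pL (unfold v w)) (uray v l).
    by rewrite /cross; ring.
  by rewrite e0 oppr0 ltxx.
split=> //; rewrite /hits -/(cone v l w) hc /=.
by move: par; rewrite wE PV => ->.
Qed.
End Track.

End TriangleAngles.

(** * Bounding the number of diagonals by the number of live words *)

Lemma esum1_le_size (R : realType) (T : choiceType) (S : set T) (s : seq T) :
  (forall x, S x -> x \in s) -> (\esum_(x in S) (1%E : \bar R) <= (size s)%:R%:E)%E.
Proof.
move=> Ss; apply: ge_ereal_sup => /= _ [A [finA AS] <-].
rewrite fsbig_finite //= sumEFin lee_fin big_const_seq count_predT iter_addr_0 ler_nat.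
apply: uniq_leq_size; first exact: fset_uniq.
by move=> x; rewrite in_fset_set // inE => /AS/Ss.
Qed.

Lemma size_flatten_le (T U : Type) (g : T -> seq U) (s : seq T) X :
  all (fun t => size (g t) <= X)%N s -> (size (flatten (map g s)) <= size s * X)%N.
Proof.
elim: s => //= t s IH /andP[h /IH h']; rewrite size_cat mulSn; exact: leq_add.
Qed.

(** A diagonal is recovered from its word, because the ray through the apex is unique by
    [hits_inj]. *)
Lemma P_count_le (R : realType) (a b : R) (v : 'I_3) (n X : nat) :
  triangle_params (a, b) ->
  (forall t, (t < n)%N ->
     count (alive (rtw a b v) (lfw a b v) (apw a b v)) (words t) <= X)%N ->
  (P_count a b v n <= (n * X)%:R%:E)%E.
Proof.
move=> hab hX.
(* On a word without a hit the default ray 0 only adds a spurious entry to the list, harmless for an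
   upper bound. *)
pose F w := (crossings a b v
  (xget 0 [set l | hits (rtw a b v) (lfw a b v) (apw a b v) w l]) w, lV (unfold a b v w)).
pose s := flatten [seq [seq F w |
  w <- seq.filter (alive (rtw a b v) (lfw a b v) (apw a b v)) (words t)] | t <- iota 0 n].
apply: (@le_trans _ _ (size s)%:R%:E).
  apply: esum1_le_size => -[p wv] [/= gd sz].
  have [l [w [sw sp Ep Ew]]] := gd_word hab gd.
  have Fw : F w = (p, wv).
    have sp' : hits (rtw a b v) (lfw a b v) (apw a b v) w
        (xget 0 [set l | hits (rtw a b v) (lfw a b v) (apw a b v) w l]).
      by case: xgetP => [x _ //|/(_ l)].
    rewrite /F (hits_inj (rtwS a b v) (lfwS a b v) (apw_beyond hab v)
      (root_cross_gt0 hab v) sp' sp) Ep Ew.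
    by [].
  apply/flattenP; exists [seq F w |
    w <- seq.filter (alive (rtw a b v) (lfw a b v) (apw a b v)) (words (size w))].
    by apply: map_f; rewrite mem_iota add0n /= -sw.
  rewrite -Fw; apply: map_f; rewrite mem_filter mem_words eqxx andbT.
  by apply: hit_alive; apply/asboolP; exists l.
rewrite lee_fin ler_nat -[n in leqRHS](size_iota 0 n); apply: size_flatten_le.
apply/allP => t; rewrite mem_iota add0n => /= tn.
by rewrite size_map size_filter hX.
Qed.

(** * Sublevel sets of integer polynomials in half-angle tangents *)

(* Over [R[i]] the value is a product of factors [t - z], one of which must be small. *)
Lemma sublevel_roots (R : realType) (P : {poly R}) (D : nat) (c e : R) :
  (size P <= D.+1)%N -> 0 < c <= `|lead_coef P| -> 0 < e <= 1 ->
  exists zs : seq R, (size zs <= D)%N /\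
    forall t, `|P.[t]| < c * e ^+ D -> exists2 z, z \in zs & `|t - z| < e.
Proof.
move=> sP /andP[c0 cP] /andP[e0 e1].
pose rc : {rmorphism R -> complex.complex R} := complex.real_complex R.
have [r Er] := closed_field_poly_normal (map_poly rc P).
have P0 : P != 0 by rewrite -lead_coef_eq0 -normr_gt0 (lt_le_trans c0).
have sr : size r = (size P).-1.
  have := congr1 (fun p : {poly _} => size p) Er.
  rewrite size_scale ?lead_coef_eq0 ?map_poly_eq0 // size_map_poly size_prod_XsubC => ->.
  by [].
exists [seq complex.Re z | z <- r]; split; first by rewrite size_map sr; move: sP; lia.
move=> t; apply: contraPP => far; apply/negP; rewrite -leNgt.
have {}far z : z \in r -> e <= `|t - complex.Re z|.
  move=> zr; rewrite leNgt; apply/negP => ?; apply: far.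
  by exists (complex.Re z) => //; apply: map_f.
have nRe (z : complex.complex R) : `|complex.Re z| <= Normc.normc z.
  by case: z => x y /=; rewrite -sqrtr_sqr ler_sqrt ?lerDl ?addr_ge0 ?sqr_ge0.
have nrc (x : R) : Normc.normc (rc x) = `|x|.
  by rewrite /= expr0n addr0 sqrtr_sqr.
rewrite -nrc -horner_map Er hornerZ Normc.normcM lead_coef_map nrc.
apply: ler_pM => //; [exact: ltW|by rewrite exprn_ge0 // ltW|].
rewrite horner_prod.
apply: (@le_trans _ _ (e ^+ size r)).
  by rewrite ler_wiXn2l // ?ltW // sr; move: sP; lia.
elim: r far {Er sr} => [|z r IH] far.
  by rewrite big_nil Normc.normc1 expr0.
rewrite big_cons Normc.normcM exprS; apply: ler_pM; rewrite ?exprn_ge0 ?(ltW e0) //.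
  rewrite !hornerE; apply: le_trans (nRe _).
  by apply: le_trans (far z _) _; [rewrite mem_head|case: (z) => x y].
by apply: IH => y yr; apply: far; rewrite inE yr orbT.
Qed.

(** Mean value theorem: the derivative of [tan] is at least 1. *)
Lemma tan_expand (R : realType) (x y : R) : 0 < x < pi -> 0 < y < pi ->
  `|x - y| <= 2 * `|tan (x / 2) - tan (y / 2)|.
Proof.
wlog xy : x y / x <= y.
  move=> H hx hy; case: (leP x y) => [|/ltW] h; first exact: H.
  by rewrite distrC [X in _ <= 2 * X]distrC; exact: H.
move=> /andP[x0 x1] /andP[y0 y1]; move: xy; rewrite le_eqVlt => /predU1P[->|xy].
  by rewrite subrr normr0 mulr_ge0.
have cpos z : x / 2 <= z <= y / 2 -> 0 < cos z.
  by move=> /andP[xz zy]; apply: cos_gt0_pihalf; apply/andP; split; lra.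
have xy2 : x / 2 < y / 2 by lra.
have [z||z + E] := @MVT R tan (fun z => (cos z) ^- 2) (x / 2) (y / 2) xy2.
- rewrite in_itv /= => /andP[xz zy]; apply: is_derive_tan.
  by apply/lt0r_neq0/cpos; rewrite !ltW.
- apply: continuous_in_subspaceT => z; rewrite inE /= in_itv /= => h.
  by apply: continuous_tan; exact: lt0r_neq0 (cpos _ h).
rewrite in_itv /= => /andP[xz zy].
have c0 : 0 < cos z by apply: cpos; rewrite !ltW.
have c2 : 1 <= (cos z) ^- 2.
  by rewrite -invr1 lef_pV2 ?posrE ?exprn_gt0 // expr_le1 ?cos_le1 // ltW.
rewrite distrC ger0_norm ?subr_ge0 ?(ltW xy) // distrC E ger0_norm; last first.
  by apply: mulr_ge0; [exact: le_trans c2|lra].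
have : 1 * (y / 2 - x / 2) <= (cos z) ^- 2 * (y / 2 - x / 2).
  by apply: ler_wpM2r => //; lra.
lra.
Qed.

Lemma measure_itv_ball (R : realType) (x e : R) : 0 <= e ->
  lebesgue_measure `[x - e, x + e] = (2 * e)%:E.
Proof.
move=> e0; rewrite lebesgue_measure_itv /= lte_fin; case: ifPn => [_|].
  by rewrite -EFinD; congr (_%:E); ring.
rewrite -leNgt => h; suff -> : e = 0 by rewrite mulr0.
by lra.
Qed.

(** Each root near which there is a half-angle tangent is replaced by one such angle; two angles for
    the same root differ by at most [4 * e]. *)
Lemma sublevel_cover (R : realType) (P : {poly R}) (D : nat) (c e : R) :
  (size P <= D.+1)%N -> 0 < c <= `|lead_coef P| -> 0 < e <= 1 ->
  exists xs : seq R, (size xs <= D)%N /\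
    forall x, 0 < x < pi -> `|P.[tan (x / 2)]| < c * e ^+ D ->
      exists2 y, y \in xs & x \in `[y - 4 * e, y + 4 * e]%R.
Proof.
move=> sP cP e01; have [zs [szs hz]] := sublevel_roots sP cP e01.
pose S z := [set x : R | 0 < x < pi /\ `|tan (x / 2) - z| < e].
exists [seq xget 0 (S z) | z <- zs]; split; first by rewrite size_map.
move=> x x0 /hz[z zzs xz]; exists (xget 0 (S z)); first exact: map_f.
have : S z (xget 0 (S z)) by apply: (xgetPex 0); exists x.
case=> y0 yz; have := tan_expand x0 y0; rewrite in_itv /= -ler_distlC.
move: yz xz; move: (xget _ _) => y yz xz.
have := ler_distD z (tan (x / 2)) (tan (y / 2)); rewrite (distrC z).
by rewrite (distrC y); lra.
Qed.

Lemma lebesgue_borel_cantelli (R : realType) (xs : nat -> seq R) (e : nat -> R) :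
  (forall r, 0 <= e r) -> (forall r, (size (xs r))%:R * e r <= 2^-1 ^+ r) ->
  lebesgue_measure.-negligible [set x : R | forall r0, exists2 r, (r0 <= r)%N &
    exists2 y, y \in xs r & x \in `[y - 4 * e r, y + 4 * e r]%R].
Proof.
move=> e0 small.
pose F r := \big[setU/set0]_(y <- xs r) `[y - 4 * e r, y + 4 * e r]%classic.
have mF r : measurable (F r) by apply: bigsetU_measurable => y _; exact: measurable_itv.
(* The bound [8 * 2^-1 ^+ r] in the form of the geometric series of [epsilon_trick0]. *)
have hF r : (lebesgue_measure (F r) <= (16 / (2 ^ r.+1)%:R)%:E)%E.
  apply: (@le_trans _ _ ((size (xs r))%:R * (8 * e r))%:E).
    rewrite /F {mF}; elim: (xs r) => [|y s IH].
      by rewrite big_nil measure0 mul0r.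
    rewrite big_cons; apply: le_trans (measureU2 _ _ _) _.
    - exact: measurable_itv.
    - by apply: bigsetU_measurable => z _; exact: measurable_itv.
    have -> : (size (y :: s))%:R * (8 * e r) = 2 * (4 * e r) + (size s)%:R * (8 * e r).
      by rewrite /= -natr1; ring.
    rewrite EFinD; apply: leeD => //; have e4 : 0 <= 4 * e r by rewrite mulr_ge0.
    by have /= -> := measure_itv_ball y e4.
  have E : 16 / (2 ^ r.+1)%:R = 8 * 2^-1 ^+ r :> R.
    by rewrite exprVn natrX exprS; field; rewrite expf_neq0.
  by rewrite lee_fin E; have := small r; lra.
have : lebesgue_measure (lim_sup_set F) = 0.
  apply: lim_sup_set_cvg0 => //.
  apply: (@le_lt_trans _ _ (\sum_(r <oo) (16 / (2 ^ r.+1)%:R)%:E)%E).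
    by apply: lee_nneseries => // r *; exact: hF.
  by apply: le_lt_trans (epsilon_trick0 _ _) (ltry _).
move=> F0; exists (lim_sup_set F); split=> //.
  by apply: bigcap_measurable => // n _; apply: bigcup_measurable => r _; exact: mF.
move=> x /= hx n _; have [r nr [y ys xy]] := hx n; exists r => //.
by rewrite /F -bigcup_seq; exists y.
Qed.

(** * Null sets for polynomials in one and in two variables *)

Section SublevelNegligible.
Variable R : realType.
Local Notation mu := (@lebesgue_measure R).

Lemma sublevel_negligible (Ps : nat -> seq {poly R}) (D : nat -> nat) (c e : nat -> R) :
  (forall r, 0 < c r) -> (forall r, 0 < e r <= 1) ->
  (forall r, (size (Ps r) * D r)%:R * e r <= 2^-1 ^+ r) ->
  mu.-negligible [set x : R | 0 < x < pi /\ forall r0, exists2 r, (r0 <= r)%N &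
    exists2 P, P \in Ps r & [/\ (size P <= (D r).+1)%N, c r <= `|lead_coef P| &
      `|P.[tan (x / 2)]| < c r * e r ^+ D r]].
Proof.
move=> c0 e01 small.
have /choice[xs hxs] (rP : nat * {poly R}) : exists xs : seq R, (size xs <= D rP.1)%N /\
    forall x, 0 < x < pi -> (size rP.2 <= (D rP.1).+1)%N -> c rP.1 <= `|lead_coef rP.2| ->
    `|rP.2.[tan (x / 2)]| < c rP.1 * e rP.1 ^+ D rP.1 ->
      exists2 y, y \in xs & x \in `[y - 4 * e rP.1, y + 4 * e rP.1]%R.
  case: rP => r P /=.
  (* A polynomial of too large degree or too small leading coefficient gets no cover. *)
  have [sP|sP] := boolP (size P <= (D r).+1)%N; last by exists [::].
  have [cP|cP] := boolP (c r <= `|lead_coef P|); last by exists [::].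
  have [ys [sy hy]] := sublevel_cover sP (introT andP (conj (c0 r) cP)) (e01 r).
  by exists ys; split=> // x x0 _ _; exact: hy.
pose ys r := flatten [seq xs (r, P) | P <- Ps r].
have sy r : (size (ys r) <= size (Ps r) * D r)%N.
  rewrite /ys; elim: (Ps r) => //= P s IH.
  by rewrite size_cat mulSn leq_add //; have [] := hxs (r, P).
have e0 r : 0 <= e r by case/andP: (e01 r) => /ltW.
apply: negligibleS (@lebesgue_borel_cantelli R ys e e0 _); last first.
  by move=> r; apply: le_trans (small r); rewrite ler_wpM2r // ler_nat.
move=> x [x0 hx] r0; have [r rr [P Pin [sP cP lt]]] := hx r0.
exists r => //; have [_ /(_ x x0 sP cP lt)[y yin xy]] := hxs (r, P).
by exists y => //; apply/flattenP; exists (xs (r, P)) => //; exact: map_f.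
Qed.

Definition evalx (t : R) (p : {poly int}) : R := (map_poly intr p).[t].

Lemma evalx_is_additive t : additive (evalx t).
Proof. by move=> p q; rewrite /evalx rmorphB /= hornerD hornerN. Qed.

Lemma evalx_is_multiplicative t : multiplicative (evalx t).
Proof. by split=> [p q|]; rewrite /evalx ?rmorphM ?rmorph1 /= ?hornerM ?hornerC. Qed.

HB.instance Definition _ t := GRing.isAdditive.Build {poly int} R (evalx t) (evalx_is_additive t).
HB.instance Definition _ t :=
  GRing.isMultiplicative.Build {poly int} R (evalx t) (evalx_is_multiplicative t).

Definition evalxy (Q : {poly {poly int}}) (t s : R) : R := (map_poly (evalx t) Q).[s].

Definition bideg (n : nat) (Q : {poly {poly int}}) :=
  (size Q <= n.+1)%N /\ forall i, (size (Q`_i)%R <= n.+1)%N.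

Lemma lead_coef_intr (p : {poly int}) : p != 0 ->
  1 <= `|lead_coef (map_poly intr p : {poly R})|.
Proof.
move=> p0; rewrite lead_coef_map_inj //; last exact: intr_inj.
rewrite -intr_norm -[1]/(1%:~R) ler_int -gtz0_ge1 normr_gt0 lead_coef_eq0 //.
Qed.

Let h (x : R) := tan (x / 2).

Lemma measurable_halftan : measurable_fun `]0, pi[ h.
Proof.
apply: open_continuous_measurable_fun; first exact: interval_open.
move=> x; rewrite inE /= in_itv /= => /andP[x0 x1].
have c0 : cos (x / 2) != 0.
  by apply/lt0r_neq0/cos_gt0_pihalf; apply/andP; split; lra.
rewrite -[h]/(tan \o ( *%R^~ 2^-1)); apply: continuous_comp.
  exact: mulrr_continuous.
exact: continuous_tan.
Qed.

Variables (Qs : nat -> seq {poly {poly int}}) (D : nat -> nat) (e : nat -> R).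
Hypothesis Qs_bideg : forall r Q, Q \in Qs r -> bideg (D r) Q.
Hypothesis e01 : forall r, 0 < e r <= 1.
Hypothesis small : forall r, (size (Qs r) * D r)%:R * e r <= 2^-1 ^+ r.

(** In the threshold, one factor [e r ^+ D r] pays for the leading coefficient, a polynomial in the
    first variable, and the other for the second variable. *)
Definition io_small : set (R * R) := [set ab | [/\ 0 < ab.1 < pi, 0 < ab.2 < pi &
  forall r0, exists2 r, (r0 <= r)%N & exists2 Q, Q \in Qs r &
    Q != 0 /\ `|evalxy Q (h ab.1) (h ab.2)| < (e r ^+ D r) * (e r ^+ D r)]].

(** The one-variable result is applied twice: first in [a] to the leading coefficients, whose own
    leading coefficients are nonzero integers, then for each good [a] to the resulting polynomials
    in [b]. *)
Lemma io_small_section : {ae mu, forall a, mu.-negligible [set b | io_small (a, b)]}.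
Proof.
have e0 r : 0 < e r by case/andP: (e01 r).
have ed0 r : 0 < e r ^+ D r by rewrite exprn_gt0.
have small1 r : (size [seq map_poly intr (lead_coef Q) : {poly R} | Q <- Qs r] * D r)%:R * e r
    <= 2^-1 ^+ r by rewrite size_map.
apply: negligibleS (sublevel_negligible (c := fun=> 1) (fun=> ltr01) e01 small1).
move=> a /= nneg; apply: contrapT => ngood; apply: nneg.
have [a01|a01] := boolP (0 < a < pi); last first.
  by apply: negligibleS (negligible_set0 _) => b [/= h1]; rewrite h1 in a01.
have {ngood} [r0 good] : exists r0, forall r Q, (r0 <= r)%N -> Q \in Qs r -> Q != 0 ->
    e r ^+ D r <= `|evalx (h a) (lead_coef Q)|.
  apply: contrapT => hr0; apply: ngood; split=> // r0; apply: contrapT => hr; apply: hr0.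
  exists r0 => r Q rr Qin Q0; rewrite leNgt; apply/negP => lt; apply: hr; exists r => //.
  exists (map_poly intr (lead_coef Q)); first by apply/mapP; exists Q.
  split; last by rewrite mul1r.
    by apply: leq_trans (size_poly _ _) _; have [_] := Qs_bideg Qin; exact.
  by apply: lead_coef_intr; rewrite lead_coef_eq0.
have small2 r : (size [seq map_poly (evalx (h a)) Q | Q <- Qs r] * D r)%:R * e r
    <= 2^-1 ^+ r by rewrite size_map; exact: small.
apply: negligibleS (sublevel_negligible (c := fun r => e r ^+ D r) ed0 e01 small2).
move=> b [/= _ b01 hr]; split=> // r1; have [r] := hr (maxn r0 r1).
rewrite geq_max => /andP[r0r r1r] [Q Qin [Q0 lt]]; exists r => //.
exists (map_poly (evalx (h a)) Q); first by apply/mapP; exists Q.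
have gl := good r Q r0r Qin Q0.
split; last exact: lt.
  by apply: leq_trans (size_poly _ _) _; have [] := Qs_bideg Qin.
have nz : evalx (h a) (lead_coef Q) != 0 by rewrite -normr_gt0 (lt_le_trans (ed0 r)).
by rewrite lead_coef_map_eq.
Qed.

Lemma measurable_evalxy Q : measurable_fun (`]0, pi[ `*` `]0, pi[)
  (fun ab : R * R => evalxy Q (h ab.1) (h ab.2)).
Proof.
have mI : measurable (`]0, pi[ : set R) by exact: measurable_itv.
have mII : measurable (`]0, pi[ `*` `]0, pi[ : set (R * R)) by exact: measurableX.
have m1 : measurable_fun (`]0, pi[ `*` `]0, pi[) (fun ab : R * R => h ab.1).
  apply: (measurable_comp (F := `]0, pi[)) => //.
  - by move=> _ [[a b] [/= ha hb] <-].
  - exact: measurable_halftan.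
  - exact: measurable_funTS.
have m2 : measurable_fun (`]0, pi[ `*` `]0, pi[) (fun ab : R * R => h ab.2).
  apply: (measurable_comp (F := `]0, pi[)) => //.
  - by move=> _ [[a b] [/= ha hb] <-].
  - exact: measurable_halftan.
  - exact: measurable_funTS.
have E (ab : R * R) : evalxy Q (h ab.1) (h ab.2) =
    \sum_(i < size Q) (\sum_(j < size (Q`_i)%R) ((Q`_i)`_j)%:~R * h ab.1 ^+ j) * h ab.2 ^+ i.
  rewrite /evalxy /map_poly horner_poly; apply: eq_bigr => i _; congr (_ * _).
  by rewrite /evalx /map_poly horner_poly.
rewrite (_ : (fun ab : R * R => _) = (fun ab : R * R =>
    \sum_(i < size Q) (\sum_(j < size (Q`_i)%R) ((Q`_i)`_j)%:~R * h ab.1 ^+ j) * h ab.2 ^+ i));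
  last by apply/funext => ab; exact: E.
apply: measurable_sum => i; apply: measurable_funM; last exact: measurable_funX.
by apply: measurable_sum => j; apply: measurable_funM => //; exact: measurable_funX.
Qed.

Lemma measurable_io_small : measurable io_small.
Proof.
have mI : measurable (`]0, pi[ : set R) by exact: measurable_itv.
have mII : measurable (`]0, pi[ `*` `]0, pi[ : set (R * R)) by exact: measurableX.
pose S r Q := (`]0, pi[ `*` `]0, pi[) `&` [set ab : R * R |
  `|evalxy Q (h ab.1) (h ab.2)| < (e r ^+ D r) * (e r ^+ D r)].
have mS r Q : measurable (S r Q).
  rewrite /S.
  rewrite (_ : [set ab | _] = (fun ab : R * R => evalxy Q (h ab.1) (h ab.2)) @^-1`
      `]- (e r ^+ D r * e r ^+ D r), (e r ^+ D r) * (e r ^+ D r)[).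
    by apply: measurable_evalxy => //; exact: measurable_itv.
  by apply/seteqP; split=> ab /=; rewrite in_itv /= ltr_norml.
pose F r := \big[setU/set0]_(Q <- Qs r | Q != 0) S r Q.
have -> : io_small = \bigcap_n \bigcup_(r in [set r | (n <= r)%N]) F r.
  apply/seteqP; split=> [ab [a01 b01 hr] n _|ab hr].
    have [r nr [Q Qin [Q0 lt]]] := hr n; exists r => //.
    rewrite /F -bigcup_seq_cond; exists Q => /=; first by rewrite Qin Q0.
    by split=> //; split; rewrite /= in_itv.
  have hr' n : exists2 r, (n <= r)%N & exists2 Q, Q \in Qs r & Q != 0 /\ S r Q ab.
    have [r /= nr] := hr n I; rewrite /F -bigcup_seq_cond => -[Q /= /andP[Qin Q0] hS].
    by exists r => //; exists Q.
  have [_ _ [_ _ [_ [[/= ha hb] _]]]] := hr' 0%N.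
  split; [by move: ha; rewrite in_itv|by move: hb; rewrite in_itv|].
  by move=> n; have [r nr [Q Qin [Q0 [_ lt]]]] := hr' n; exists r => //; exists Q.
apply: bigcap_measurable => // n _; apply: bigcup_measurable => r _.
by apply: bigsetU_measurable => Q _; exact: mS.
Qed.

(** Fubini: the set is measurable, and almost every section has measure zero. *)
Lemma io_small_negligible : (mu \x mu)%E.-negligible io_small.
Proof.
exists io_small; split=> //; first exact: measurable_io_small.
have mE := measurable_io_small.
have mphi := measurable_fun_xsection mu mE.
rewrite /product_measure1.
transitivity (\int[mu]_x `|(mu \o xsection io_small) x|)%E.
  by apply: eq_integral => x _; rewrite gee0_abs // measure_ge0.
have [_ ->] := @ae_eq_integral_abs _ _ R mu setT measurableT _ mphi.
  by [].
apply: negligibleS io_small_section => a /= nz neg; apply: nz => _ /=.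
apply/negligibleP; first exact: measurable_xsection.
by apply: negligibleS neg => b /xsectionP.
Qed.

Theorem evalxy_gap : {ae (mu \x mu)%E, forall ab, 0 < ab.1 < pi -> 0 < ab.2 < pi ->
  exists r0, forall r Q, (r0 <= r)%N -> Q \in Qs r -> Q != 0 ->
    (e r ^+ D r) * (e r ^+ D r) <= `|evalxy Q (tan (ab.1 / 2)) (tan (ab.2 / 2))|}.
Proof.
apply: negligibleS io_small_negligible => ab /= nok; split.
- by apply: contrapT => h1; apply: nok => h2; case: h1.
- by apply: contrapT => h1; apply: nok => _ h2; case: h1.
move=> r0; apply: contrapT => h0; apply: nok => _ _; exists r0 => r Q rr Qin Q0.
rewrite leNgt; apply/negP => lt; apply: h0; exists r => //; exists Q => //.
Qed.

End SublevelNegligible.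

(** * Trigonometric polynomials attached to unfolded copies *)

Lemma bideg_le n m Q : (n <= m)%N -> bideg n Q -> bideg m Q.
Proof.
by move=> nm [h1 h2]; split=> [|i]; [apply: leq_trans h1 _|apply: leq_trans (h2 i) _].
Qed.

Lemma bidegD n P Q : bideg n P -> bideg n Q -> bideg n (P + Q).
Proof.
move=> [p1 p2] [q1 q2]; split=> [|i].
  by apply: leq_trans (size_polyD _ _) _; rewrite geq_max p1.
by rewrite coefD; apply: leq_trans (size_polyD _ _) _; rewrite geq_max p2 q2.
Qed.

Lemma bidegN n Q : bideg n Q -> bideg n (- Q).
Proof. by move=> [q1 q2]; split=> [|i]; rewrite ?coefN size_polyN. Qed.

Lemma bidegM n m P Q : bideg n P -> bideg m Q -> bideg (n + m) (P * Q).
Proof.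
move=> [p1 p2] [q1 q2].
have mul (T : nzRingType) (p q : {poly T}) : (size p <= n.+1)%N -> (size q <= m.+1)%N ->
    (size (p * q)%R <= (n + m).+1)%N.
  by move=> sp sq; apply: leq_trans (size_polyMleq _ _) _; lia.
split=> [|i]; first exact: mul.
rewrite coefM; apply: leq_trans (size_sum _ _ _) _.
by apply/bigmax_leqP => j _; exact: mul.
Qed.

Lemma bideg1 n : bideg n 1.
Proof.
split=> [|i]; first by rewrite size_poly1.
by rewrite coef1; case: (i == _); rewrite ?size_poly1 ?size_poly0.
Qed.

Lemma bidegX : bideg 1 'X.
Proof.
split=> [|i]; first by rewrite size_polyX.
by rewrite coefX; case: (i == _); rewrite ?size_poly1 ?size_poly0.
Qed.

Lemma bidegXC : bideg 1 ('X%:P).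
Proof.
split=> [|i]; first by rewrite (leq_trans (size_polyC_leq1 _)).
by rewrite coefC; case: (i == _); rewrite ?size_polyX ?size_poly0.
Qed.

Lemma bideg_exp n i Q : bideg n Q -> bideg (n * i) (Q ^+ i).
Proof.
move=> h; elim: i => [|i IH]; first by rewrite expr0; exact: bideg1.
by rewrite exprS mulnS; exact: bidegM.
Qed.

Section TrigPoly.
Variable R : realType.
Implicit Types (f g : R -> R -> R).

Lemma evalxyD P Q (t s : R) : evalxy (P + Q) t s = evalxy P t s + evalxy Q t s.
Proof. by rewrite /evalxy rmorphD /= hornerD. Qed.

Lemma evalxyN Q (t s : R) : evalxy (- Q) t s = - evalxy Q t s.
Proof. by rewrite /evalxy rmorphN /= hornerN. Qed.

Lemma evalxyM P Q (t s : R) : evalxy (P * Q) t s = evalxy P t s * evalxy Q t s.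
Proof. by rewrite /evalxy rmorphM /= hornerM. Qed.

Lemma evalxy1 (t s : R) : evalxy 1 t s = 1.
Proof. by rewrite /evalxy rmorph1 /= hornerC. Qed.

Lemma evalxyX (t s : R) : evalxy 'X t s = s.
Proof. by rewrite /evalxy map_polyX hornerX. Qed.

Lemma evalxyXC (t s : R) : evalxy 'X%:P t s = t.
Proof. by rewrite /evalxy map_polyC hornerC /= /evalx map_polyX hornerX. Qed.

Lemma evalxy_exp Q n (t s : R) : evalxy (Q ^+ n) t s = evalxy Q t s ^+ n.
Proof. by elim: n => [|n IH]; rewrite ?expr0 ?evalxy1 // !exprS evalxyM IH. Qed.

Definition evalxyE := (evalxyD, evalxyN, evalxyM, evalxy1, evalxyX, evalxyXC, evalxy_exp).

Definition tanden (a b : R) := (1 + tan (a / 2) ^+ 2) * (1 + tan (b / 2) ^+ 2).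

(* [f] is a trigonometric polynomial with integer coefficients, written in half-angle
   tangents with an explicit common denominator. *)
Definition trigpoly k f := exists2 Q, bideg (4 * k) Q & forall a b,
  cos (a / 2) != 0 -> cos (b / 2) != 0 ->
  f a b * tanden a b ^+ k = evalxy Q (tan (a / 2)) (tan (b / 2)).

Lemma trigpolyM k l f g : trigpoly k f -> trigpoly l g ->
  trigpoly (k + l) (fun a b => f a b * g a b).
Proof.
move=> [P dP hP] [Q dQ hQ]; exists (P * Q); first by rewrite mulnDr; exact: bidegM.
by move=> a b ca cb; rewrite exprD mulrACA hP // hQ // evalxyM.
Qed.

Lemma trigpolyD k f g : trigpoly k f -> trigpoly k g -> trigpoly k (fun a b => f a b + g a b).
Proof.
move=> [P dP hP] [Q dQ hQ]; exists (P + Q); first exact: bidegD.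
by move=> a b ca cb; rewrite mulrDl hP // hQ // evalxyD.
Qed.

Lemma trigpolyN k f : trigpoly k f -> trigpoly k (fun a b => - f a b).
Proof.
move=> [P dP hP]; exists (- P); first exact: bidegN.
by move=> a b ca cb; rewrite mulNr hP // evalxyN.
Qed.

(** The numerator is multiplied by a power of the common denominator, whose bidegree is at most
    4. *)
Lemma trigpoly_le k l f : (k <= l)%N -> trigpoly k f -> trigpoly l f.
Proof.
move=> kl [P dP hP].
exists (P * ((1 + 'X%:P ^+ 2) * (1 + 'X ^+ 2)) ^+ (l - k)).
  rewrite -(subnKC kl) mulnDr addKn; apply: bidegM => //; apply: bideg_exp.
  rewrite (_ : 4 = 2 + 2)%N //; apply: bidegM; apply: bidegD; try exact: bideg1.
    exact: bideg_exp bidegXC.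
  exact: bideg_exp bidegX.
by move=> a b ca cb; rewrite -{1}(subnKC kl) exprD mulrA hP // !evalxyE.
Qed.

Lemma trigpoly_ext k f g : (forall a b, f a b = g a b) -> trigpoly k f -> trigpoly k g.
Proof. by move=> fg [P dP hP]; exists P => // a b ca cb; rewrite -fg hP. Qed.

Lemma trigpoly0 k : trigpoly k (fun _ _ => 0).
Proof.
exists 0; last by move=> a b _ _; rewrite mul0r /evalxy rmorph0 horner0.
by split=> [|i]; rewrite ?coef0 size_poly0.
Qed.

Lemma trigpoly1 k : trigpoly k (fun _ _ => 1).
Proof.
apply: (@trigpoly_le 0) => //; exists 1; first exact: bideg1.
by move=> a b _ _; rewrite mul1r expr0 evalxy1.
Qed.

(** Rational parametrization of the circle, cleared of denominators. *)
Lemma half_angle (a : R) : cos (a / 2) != 0 ->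
  cos a * (1 + tan (a / 2) ^+ 2) = 1 - tan (a / 2) ^+ 2 /\
  sin a * (1 + tan (a / 2) ^+ 2) = tan (a / 2) + tan (a / 2).
Proof.
have -> : cos a = cos (a / 2 + a / 2) by congr cos; field.
have -> : sin a = sin (a / 2 + a / 2) by congr sin; field.
rewrite cosD sinD /tan; have := cos2Dsin2 (a / 2).
move: (cos _) (sin _) => c s h c0; split.
  transitivity ((c * c - s * s) * (c ^+ 2 + s ^+ 2) / c ^+ 2); first by field.
  by rewrite h; field.
transitivity ((s * c + c * s) * (c ^+ 2 + s ^+ 2) / c ^+ 2); first by field.
by rewrite h; field.
Qed.

Let denX : bideg 2 (1 + 'X ^+ 2).
Proof. by apply: bidegD; [exact: bideg1|exact: bideg_exp bidegX]. Qed.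
Let denXC : bideg 2 (1 + 'X%:P ^+ 2).
Proof. by apply: bidegD; [exact: bideg1|exact: bideg_exp bidegXC]. Qed.

Lemma trigpoly_cos1 : trigpoly 1 (fun a _ => cos a).
Proof.
exists ((1 - 'X%:P ^+ 2) * (1 + 'X ^+ 2)).
  apply: (@bidegM 2 2) denX; apply: bidegD; first exact: bideg1.
  by apply: bidegN; exact: bideg_exp bidegXC.
move=> a b ca cb; rewrite expr1 mulrA !evalxyE.
by have [-> _] := half_angle ca.
Qed.

Lemma trigpoly_sin1 : trigpoly 1 (fun a _ => sin a).
Proof.
exists (('X%:P + 'X%:P) * (1 + 'X ^+ 2)).
  by apply: (@bidegM 2 2) denX; apply: (@bideg_le 1) => //; apply: bidegD; exact: bidegXC.
move=> a b ca cb; rewrite expr1 mulrA !evalxyE.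
by have [_ ->] := half_angle ca.
Qed.

Lemma trigpoly_cos2 : trigpoly 1 (fun _ b => cos b).
Proof.
exists ((1 - 'X ^+ 2) * (1 + 'X%:P ^+ 2)).
  apply: (@bidegM 2 2) denXC; apply: bidegD; first exact: bideg1.
  by apply: bidegN; exact: bideg_exp bidegX.
move=> a b ca cb; rewrite expr1 [tanden _ _]mulrC mulrA !evalxyE.
by have [-> _] := half_angle cb.
Qed.

Lemma trigpoly_sin2 : trigpoly 1 (fun _ b => sin b).
Proof.
exists (('X + 'X) * (1 + 'X%:P ^+ 2)).
  by apply: (@bidegM 2 2) denXC; apply: (@bideg_le 1) => //; apply: bidegD; exact: bidegX.
move=> a b ca cb; rewrite expr1 [tanden _ _]mulrC mulrA !evalxyE.
by have [_ ->] := half_angle cb.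
Qed.

Lemma trigpoly_ang i :
  trigpoly 2 (fun a b => cos (ang a b i)) /\ trigpoly 2 (fun a b => sin (ang a b i)).
Proof.
have le f : trigpoly 1 f -> trigpoly 2 f by exact: trigpoly_le.
move: i; apply: ord3P.
- by split; [apply: trigpoly_ext (le _ trigpoly_cos1)|apply: trigpoly_ext (le _ trigpoly_sin1)]
    => a b; rewrite ang0.
- by split; [apply: trigpoly_ext (le _ trigpoly_cos2)|apply: trigpoly_ext (le _ trigpoly_sin2)]
    => a b; rewrite ang1.
have h (a b : R) : a + b + (pi - a - b) = pi by ring.
split.
  apply: trigpoly_ext (trigpolyD (trigpolyM trigpoly_sin1 trigpoly_sin2)
    (trigpolyN (trigpolyM trigpoly_cos1 trigpoly_cos2))) => a b.
  by rewrite ang2 (cos_sum_pi (h a b)).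
apply: trigpoly_ext (trigpolyD (trigpolyM trigpoly_sin1 trigpoly_cos2)
  (trigpolyM trigpoly_cos1 trigpoly_sin2)) => a b.
by rewrite ang2 (sin_sum_pi (h a b)).
Qed.

(** Unfolding restarted from a standard position: it depends on the labels and on the turns of a
    window, but not on the earlier word. *)
Definition local_state (a b : R) x y z w : state R :=
  foldr (step a b) (State x y z (0, 0) 0) w.

Lemma trigpoly_cosD k l f g : trigpoly k (fun a b => cos (f a b)) ->
  trigpoly k (fun a b => sin (f a b)) -> trigpoly l (fun a b => cos (g a b)) ->
  trigpoly l (fun a b => sin (g a b)) ->
  [/\ trigpoly (k + l) (fun a b => cos (f a b + g a b)),
      trigpoly (k + l) (fun a b => sin (f a b + g a b)),
      trigpoly (k + l) (fun a b => cos (f a b - g a b)) &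
      trigpoly (k + l) (fun a b => sin (f a b - g a b))].
Proof.
move=> cf sf cg sg; split.
- by apply: trigpoly_ext (trigpolyD (trigpolyM cf cg) (trigpolyN (trigpolyM sf sg))) => a b;
    rewrite cosD.
- by apply: trigpoly_ext (trigpolyD (trigpolyM sf cg) (trigpolyM cf sg)) => a b; rewrite sinD.
- by apply: trigpoly_ext (trigpolyD (trigpolyM cf cg) (trigpolyM sf sg)) => a b; rewrite cosB.
- by apply: trigpoly_ext (trigpolyD (trigpolyM sf cg) (trigpolyN (trigpolyM cf sg))) => a b;
    rewrite sinB.
Qed.

(** Each turn changes the phase by one angle, of degree 2. An apex adds 4 to the degree of the
    phase: 2 for its angle and 2 for its side length. *)
Lemma trigpoly_state x y z w : let n := (2 * size w)%N in exists x' y' z',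
  [/\ (forall a b, [/\ lR (local_state a b x y z w) = x', lL (local_state a b x y z w) = y' &
        lV (local_state a b x y z w) = z']),
      trigpoly n (fun a b => cos (phase (local_state a b x y z w))) /\
      trigpoly n (fun a b => sin (phase (local_state a b x y z w))),
      trigpoly (n + 4) (fun a b => (pos (local_state a b x y z w)).1) /\
      trigpoly (n + 4) (fun a b => (pos (local_state a b x y z w)).2) &
      trigpoly (n + 4) (fun a b => (pV a b (local_state a b x y z w)).1) /\
      trigpoly (n + 4) (fun a b => (pV a b (local_state a b x y z w)).2)].
Proof.
have apex n (s : R -> R -> state R) x' y' :
    (forall a b, lR (s a b) = x' /\ lL (s a b) = y') ->
    trigpoly n (fun a b => cos (phase (s a b))) -> trigpoly n (fun a b => sin (phase (s a b))) ->
    trigpoly (n + 4) (fun a b => (pos (s a b)).1) ->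
    trigpoly (n + 4) (fun a b => (pos (s a b)).2) ->
    trigpoly (n + 4) (fun a b => (pV a b (s a b)).1) /\
    trigpoly (n + 4) (fun a b => (pV a b (s a b)).2).
  move=> lab cph sph px py; have [cx sx] := trigpoly_ang x'; have [_ sy] := trigpoly_ang y'.
  have [_ _ c s'] := trigpoly_cosD cph sph cx sx.
  rewrite (_ : n + 4 = 2 + (n + 2))%N in px py *; last by lia.
  split.
    apply: trigpoly_ext (trigpolyD px (trigpolyM sy c)) => a b.
    by rewrite /pV; have [-> ->] := lab a b.
  apply: trigpoly_ext (trigpolyD py (trigpolyM sy s')) => a b.
  by rewrite /pV; have [-> ->] := lab a b.
elim: w => [|c w [x' [y' [z' [lab [cph sph] [px py] [vx vy]]]]]] n.
  exists x, y, z; rewrite /n muln0.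
  have c0 : trigpoly 0 (fun _ _ => cos 0) by apply: trigpoly_ext (trigpoly1 0) => *; rewrite cos0.
  have s0 : trigpoly 0 (fun _ _ => sin 0) by apply: trigpoly_ext (trigpoly0 0) => *; rewrite sin0.
  have z4 := trigpoly0 (0 + 4).
  by split=> //; apply: (@apex 0%N (fun _ _ => State x y z (0, 0) 0) x y).
have [cx sx] := trigpoly_ang x'; have [cy sy] := trigpoly_ang y'.
have [cp sp _ _] := trigpoly_cosD cph sph cy sy; have [_ _ cm sm] := trigpoly_cosD cph sph cx sx.
have En : (2 * size w + 2 = n)%N by rewrite /n /=; lia.
rewrite {}En in cp sp cm sm.
have le f : trigpoly (2 * size w + 4) f -> trigpoly (n + 4) f.
  by apply: trigpoly_le; rewrite /n /=; lia.
have lab1 a b : lR (local_state a b x y z w) = x' by have [] := lab a b.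
have lab2 a b : lL (local_state a b x y z w) = y' by have [] := lab a b.
have lab3 a b : lV (local_state a b x y z w) = z' by have [] := lab a b.
have {}cp : trigpoly n (fun a b => cos (phase (local_state a b x y z w) +
    ang a b (lL (local_state a b x y z w)))) by apply: trigpoly_ext cp => a b; rewrite lab2.
have {}sp : trigpoly n (fun a b => sin (phase (local_state a b x y z w) +
    ang a b (lL (local_state a b x y z w)))) by apply: trigpoly_ext sp => a b; rewrite lab2.
have {}cm : trigpoly n (fun a b => cos (phase (local_state a b x y z w) -
    ang a b (lR (local_state a b x y z w)))) by apply: trigpoly_ext cm => a b; rewrite lab1.
have {}sm : trigpoly n (fun a b => sin (phase (local_state a b x y z w) -
    ang a b (lR (local_state a b x y z w)))) by apply: trigpoly_ext sm => a b; rewrite lab1.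
clearbody n; case: c.
  exists z', y', x'; split; [by move=> a b; split=> /=|by split|by split; apply: le|].
  apply: (@apex n (fun a b => local_state a b x y z (true :: w)) z' y') => //;
    by [apply: le | move=> a b /=].
exists x', z', y'; split; [by move=> a b; split=> /=|by split|by split; apply: le|].
apply: (@apex n (fun a b => local_state a b x y z (false :: w)) x' z') => //;
  by [apply: le | move=> a b /=].
Qed.

End TrigPoly.

(** * Lower bound for nonzero areas in almost every triangle *)

Section AreaGap.
Variable R : realType.
Implicit Types (a b : R).

Definition rot (f : R) (p : R * R) : R * R :=
  (cos f * p.1 - sin f * p.2, sin f * p.1 + cos f * p.2).

Lemma pV_move a b x y z z' p f (r : state R) :
  lR r = x -> lL r = y -> lV r = z ->
  pV a b (State x y z' (padd p (rot f (pos r))) (f + phase r)) = padd p (rot f (pV a b r)).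
Proof.
move=> <- <- _; rewrite /pV /= -(addrA f (phase r)) /padd /pscale /rot /cis /= (cosD f) (sinD f).
by congr (_, _); ring.
Qed.

(** [step] commutes with rigid motions. *)
Lemma foldr_step_move a b x y z p f w :
  let r := local_state a b x y z w in
  foldr (step a b) (State x y z p f) w =
  State (lR r) (lL r) (lV r) (padd p (rot f (pos r))) (f + phase r).
Proof.
rewrite /local_state; elim: w => [|c w IH] /=.
  by rewrite /padd /rot /= !mulr0 addr0 subr0 !addr0 -surjective_pairing.
rewrite IH; set r := foldr _ _ w; rewrite /step; case: c => /=.
  by rewrite (@pV_move _ _ _ _ (lV r)) // addrA.
by rewrite addrA.
Qed.

Definition local_area (xyz : 'I_3 * 'I_3 * 'I_3) (y2 y3 : seq bool) a b : R :=
  let ap w := pV a b (local_state a b xyz.1.1 xyz.1.2 xyz.2 w) in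
  cross ((ap y2).1 - (ap [::]).1, (ap y2).2 - (ap [::]).2)
        ((ap (y3 ++ y2)).1 - (ap [::]).1, (ap (y3 ++ y2)).2 - (ap [::]).2).

(** Area is invariant under rigid motions, so among all [v] and [w] only finitely many labellings
    matter; this makes the list of polynomials finite. *)
Lemma area_local a b v w y2 y3 : exists xyz,
  area (apw a b v) w (y2 ++ w) (y3 ++ y2 ++ w) = local_area xyz y2 y3 a b.
Proof.
case Es : (unfold a b v w) => [x y z p f]; exists (x, y, z).
have apE u : apw a b v (u ++ w) = padd p (rot f (pV a b (local_state a b x y z u))).
  rewrite /apw /unfold foldr_cat -/(unfold a b v w) Es foldr_step_move /=.
  exact: pV_move.
have ap0 := apE [::]; rewrite /area catA !apE ap0 /local_area.
move: (pV a b (local_state a b x y z [::])) (pV a b (local_state a b x y z y2))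
  (pV a b (local_state a b x y z (y3 ++ y2))) => p1 p2 p3.
rewrite /cross /padd /rot /=.
transitivity (((p2.1 - p1.1) * (p3.2 - p1.2) - (p2.2 - p1.2) * (p3.1 - p1.1)) *
  (cos f * cos f + sin f * sin f)); last by rewrite cos2sin2E; ring.
by ring.
Qed.

(** Words of length at most [2 m] give coordinates of degree [4 * m + 4], and areas are quadratic in
    them. *)
Lemma trigpoly_local_area m xyz y2 y3 : (size y2 <= m)%N -> (size y3 <= m)%N ->
  trigpoly (8 * m + 8) (local_area xyz y2 y3).
Proof.
case: xyz => [[x y] z] s2 s3.
have ap w : (size w <= m + m)%N ->
    trigpoly (4 * m + 4) (fun a b => (pV a b (local_state a b x y z w)).1) /\
    trigpoly (4 * m + 4) (fun a b => (pV a b (local_state a b x y z w)).2).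
  move=> sw; have [x' [y' [z' [_ _ _ [h1 h2]]]]] := trigpoly_state R x y z w.
  by split; [apply: trigpoly_le h1|apply: trigpoly_le h2]; lia.
have [a1 a2] := ap [::] isT.
have [b1 b2] := ap y2 (leq_trans s2 (leq_addr _ _)).
have s32 : (size (y3 ++ y2) <= m + m)%N by rewrite size_cat leq_add.
have [c1 c2] := ap _ s32.
rewrite (_ : 8 * m + 8 = (4 * m + 4) + (4 * m + 4))%N; last by lia.
exact: trigpolyD
  (trigpolyM (trigpolyD b1 (trigpolyN a1)) (trigpolyD c2 (trigpolyN a2)))
  (trigpolyN (trigpolyM (trigpolyD b2 (trigpolyN a2)) (trigpolyD c1 (trigpolyN a1)))).
Qed.

Definition short_words m := flatten [seq words t | t <- iota 0 m].

Lemma mem_short_words m w : (size w < m)%N -> w \in short_words m.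
Proof.
move=> sw; apply/flattenP; exists (words (size w)); last by rewrite mem_words.
by apply: map_f; rewrite mem_iota.
Qed.

Lemma size_words n : size (words n) = (2 ^ n)%N.
Proof. by elim: n => //= n IH; rewrite size_cat !size_map IH expnS mul2n addnn. Qed.

Lemma size_short_words m : (size (short_words m) <= 2 ^ m)%N.
Proof.
suff : size (short_words m) = (2 ^ m - 1)%N by lia.
elim: m => // m IH; rewrite /short_words -addn1 iotaD map_cat flatten_cat size_cat.
by rewrite -/(short_words m) IH /= cats0 size_words addn1 add0n expnS; have := expn_gt0 2 m; lia.
Qed.

(* The square of [e ^ D], where [D = 32 m + 32] bounds the bidegrees of the polynomials given by
   the areas in windows of length [m], and [e = 2 ^ - (3 m + 10 + r)] is small enough for their
   number times [D e] to be at most [2 ^ - r]. *)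
Definition gap (m r : nat) : R := 2^-1 ^+ ((3 * m + 10 + r) * (2 * (32 * m + 32))).

Lemma area_gap_ae (m : nat -> nat) :
  {ae ((@lebesgue_measure R) \x (@lebesgue_measure R))%E, forall ab : R * R,
    triangle_params ab -> exists r0, forall r, (r0 <= r)%N -> forall v w y2 y3,
    (size y2 < m r)%N -> (size y3 < m r)%N ->
    area (apw ab.1 ab.2 v) w (y2 ++ w) (y3 ++ y2 ++ w) != 0 ->
    gap (m r) r <=
      `|area (apw ab.1 ab.2 v) w (y2 ++ w) (y3 ++ y2 ++ w)| * tanden ab.1 ab.2 ^+ (8 * m r + 8)}.
Proof.
have /choice[Qf hQf] (i : nat * (('I_3 * 'I_3 * 'I_3) * (seq bool * seq bool))) :
    exists Q, bideg (32 * i.1 + 32) Q /\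
    ((size i.2.2.1 < i.1)%N -> (size i.2.2.2 < i.1)%N -> forall a b : R,
     cos (a / 2) != 0 -> cos (b / 2) != 0 ->
     local_area i.2.1 i.2.2.1 i.2.2.2 a b * tanden a b ^+ (8 * i.1 + 8) =
       evalxy Q (tan (a / 2)) (tan (b / 2))).
  case: i => n [xyz [y2 y3]] /=.
  (* Words too long for the window are given the arbitrary polynomial 1. *)
  case: (leqP n (size y2)) => s2.
    by exists 1; split=> [|//]; exact: bideg1.
  case: (leqP n (size y3)) => s3.
    by exists 1; split=> [|_ //]; exact: bideg1.
  have [Q dQ hQ] := trigpoly_local_area xyz (ltnW s2) (ltnW s3).
  by exists Q; split=> //; apply: bideg_le dQ; lia.
pose idx n := [seq (xyz, y23) | xyz <- enum {: 'I_3 * 'I_3 * 'I_3},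
  y23 <- [seq (y2, y3) | y2 <- short_words n, y3 <- short_words n]].
pose Qs r := [seq Qf (m r, i) | i <- idx (m r)].
pose D r := (32 * m r + 32)%N.
pose e r : R := 2^-1 ^+ (3 * m r + 10 + r).
have half01 n : 0 < (2^-1 : R) ^+ n <= 1.
  by rewrite exprn_gt0 //= exprn_ile1 //; lra.
have Qs_bideg r Q : Q \in Qs r -> bideg (D r) Q.
  by move=> /mapP[i _ ->]; have [] := hQf (m r, i).
have small r : (size (Qs r) * D r)%:R * e r <= 2^-1 ^+ r.
  rewrite /e exprD mulrA ler_piMl //.
  rewrite exprVn ler_pdivrMr ?exprn_gt0 // mul1r -natrX ler_nat.
  rewrite size_map !size_allpairs -cardE !card_prod !card_ord.
  have := size_short_words (m r); set s := size _ => ss.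
  have mm : (m r < 2 ^ m r)%N by exact: ltn_expl.
  (* The 27 labellings fit in [2 ^ 5], the two words in [2 ^ m r] each, and [D r] in
     [2 ^ 5 * 2 ^ m r]. *)
  have -> : (2 ^ (3 * m r + 10))%N = ((2 ^ 5 * (2 ^ m r * 2 ^ m r)) * (2 ^ 5 * 2 ^ m r))%N.
    by rewrite -!expnD; congr expn; lia.
  apply: leq_mul; first by apply: leq_mul; last exact: leq_mul.
  by rewrite /D addnC -mulnS (_ : 2 ^ 5 = 32)%N // leq_mul2l ltn_expl.
apply: negligibleS (evalxy_gap Qs_bideg (fun r => half01 _) small) => ab /= nok ok; apply: nok.
move=> [a0 [b0 ab0]].
have [||r0 hr0] := ok; [by apply/andP; split; lra|by apply/andP; split; lra|].
have cn (x : R) : 0 < x < pi -> cos (x / 2) != 0.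
  by move=> /andP[x0 x1]; apply/lt0r_neq0/cos_gt0_pihalf; apply/andP; split; lra.
have c1 : cos (ab.1 / 2) != 0 by apply: cn; apply/andP; split; lra.
have c2 : cos (ab.2 / 2) != 0 by apply: cn; apply/andP; split; lra.
have t1 : 0 < tanden ab.1 ab.2.
  by apply: mulr_gt0; apply: ltr_pwDl => //; exact: sqr_ge0.
exists r0 => r rr v w y2 y3 s2 s3 nz.
have [xyz E] := area_local ab.1 ab.2 v w y2 y3.
have [_ /(_ s2 s3 _ _ c1 c2) /= EQ] := hQf (m r, (xyz, (y2, y3))).
have td0 : 0 < tanden ab.1 ab.2 ^+ (8 * m r + 8) by rewrite exprn_gt0.
rewrite -[X in _ * X](gtr0_norm td0) -normrM E EQ.
have -> : gap (m r) r = e r ^+ D r * e r ^+ D r.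
  by rewrite /gap /e /D -exprD -exprM addnn mul2n.
apply: hr0 => //.
  apply: map_f; apply/allpairsP; exists (xyz, (y2, y3)); rewrite mem_enum; split=> //.
  by apply/allpairsP; exists (y2, y3); split=> //=; exact: mem_short_words.
(* A nonzero area at this triangle shows that its polynomial is not identically zero. *)
apply: contraNneq nz => Q0; rewrite E -(mulIr_eq0 _ (mulIf (lt0r_neq0 td0))) EQ Q0.
by rewrite /evalxy rmorph0 horner0.
Qed.

End AreaGap.

(** * Choice of the parameters *)

Lemma limn_einf_le (R : realType) (u : nat -> \bar R) (c : \bar R) :
  (forall n0, exists2 n, (n0 <= n)%N & (u n <= c)%E) -> (limn_einf u <= c)%E.
Proof.
move=> h; rewrite limn_einf_lim; apply: lime_le; first exact: is_cvg_einfs.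
apply: nearW => n0; have [n nn un] := h n0.
by apply: le_trans un; apply: ereal_inf_lbound; exists n.
Qed.

Lemma leq_exp2_pow r i : (r ^ i <= 2 ^ (i * r))%N.
Proof. by rewrite mulnC expnM; case: i => [//|i]; rewrite leq_exp2r // ltnW // ltn_expl. Qed.

Lemma le_pow2 (R : realType) (x : R) : exists A, x <= 2 ^+ A.
Proof.
exists (Num.bound `|x|); apply: le_trans (ler_norm x) _.
have := archi_boundP (normr_ge0 x) => /ltW /le_trans; apply.
by rewrite -natrX ler_nat ltnW // ltn_expl.
Qed.

(** The terms come from [3 / kappa], the heights, the denominators and the gap. The gap dominates,
    with at most [14 * 128 = 1792] times [r ^ 32]. *)
Lemma grid_exponent A r : (A + 2000 <= r)%N ->
  (A + 2 * (48 * r + 2) + A * (8 * r ^ 16 + 8) +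
   (3 * r ^ 16 + 10 + r) * (2 * (32 * r ^ 16 + 32)) < r ^ 34)%N.
Proof.
move=> Ar; have rX : (r <= r ^ 16)%N by rewrite -[leqLHS]expn1 leq_pexp2l //; lia.
have -> : (r ^ 34 = (r ^ 16 * r ^ 16) * (r * r))%N by rewrite -!expnD mulnn -expnD.
move: rX; set X := (r ^ 16)%N => rX.
have h1 : ((3 * X + 10 + r) * (2 * (32 * X + 32)) <= 14 * X * (128 * X))%N.
  by apply: leq_mul; lia.
have h2 : (A * (8 * X + 8) <= X * (16 * X))%N by apply: leq_mul; lia.
have h3 : (2000 * 1 <= r * r)%N by apply: leq_mul; lia.
have h4 : (X * 1 <= X * X)%N by apply: leq_mul; lia.
have h5 : ((X * X) * 2000 <= (X * X) * (r * r))%N by apply: leq_mul; lia.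
lia.
Qed.

Lemma exponent_sum r X Y N : (20 <= r)%N -> (r <= X)%N -> Y = (X * X)%N -> N = (Y * (r * r))%N ->
  (48 * r + ((16 * r + 2) * Y + (N + 1 + 2 * X)) <= 2 * N)%N.
Proof.
move=> r20 rX -> ->.
have XY : (X * 1 <= X * X)%N by apply: leq_mul; lia.
have h : (X * X * (53 + 16 * r) <= X * X * (r * r))%N.
  have : (20 * r <= r * r)%N by rewrite leq_mul2r r20 orbT.
  by move=> ?; apply: leq_mul => //; lia.
lia.
Qed.

(** The [r ^ 32] windows cost about [16 r] bits each, less than the [r ^ 34] bits of the grid; the
    factor [r ^ 48] sums over word lengths. *)
Lemma count_exponent r : (20 <= r)%N ->
  (r ^ 48 * ((r ^ 16).*2.+2 ^ (r ^ 32) * ((2 ^ (r ^ 34)).+1 * 4 ^ (r ^ 16))) <=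
   2 ^ (2 * r ^ 34))%N.
Proof.
move=> r20.
have rX : (r <= r ^ 16)%N by rewrite -[leqLHS]expn1 leq_pexp2l //; lia.
have EY : (r ^ 32 = r ^ 16 * r ^ 16)%N by rewrite -expnD.
have EN : (r ^ 34 = r ^ 32 * (r * r))%N by rewrite mulnn -expnD.
have h1 := leq_exp2_pow r 48; have h2 := leq_exp2_pow r 16.
have h3 : ((r ^ 16).*2.+2 <= 2 ^ (16 * r + 2))%N.
  by rewrite expnD (_ : 2 ^ 2 = 4)%N //; lia.
have h4 : ((r ^ 16).*2.+2 ^ (r ^ 32) <= 2 ^ ((16 * r + 2) * r ^ 32))%N.
  by rewrite expnM leq_exp2r // expn_gt0; lia.
have h5 : ((2 ^ (r ^ 34)).+1 <= 2 ^ (r ^ 34 + 1))%N.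
  by rewrite expnD expn1; have := expn_gt0 2 (r ^ 34); lia.
have h6 : (4 ^ (r ^ 16) = 2 ^ (2 * r ^ 16))%N by rewrite expnM.
apply: (@leq_trans (2 ^ (48 * r + ((16 * r + 2) * r ^ 32 + (r ^ 34 + 1 + 2 * r ^ 16))))).
  rewrite expnD; apply: leq_mul => //; rewrite expnD; apply: leq_mul => //.
  by rewrite expnD h6 leq_mul2r h5 orbT.
rewrite (leq_exp2l _ _ (isT : 1 < 2)%N).
exact: exponent_sum r20 rX EY EN.
Qed.

(* So that [48 (sqrt 3 - 1) >= 35 > 34]. *)
Lemma sqrt3_lower (R : realType) : 83 / 48 <= Num.sqrt 3 :> R.
Proof.
rewrite -(@ger0_norm R (83 / 48)); last by lra.
rewrite -sqrtr_sqr ler_sqrt; last by lra.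
by rewrite expr2; lra.
Qed.

(** * Growth of [P_count] in a triangle with the area gap *)

Section Growth.
Variables (R : realType) (a b : R).
Hypothesis hab : triangle_params (a, b).

Lemma height_le v w : `|height (rtw a b v) (lfw a b v) (apw a b v) w| <= (size w).+2%:R.
Proof.
have [_ h] := apw_norm a b v w.
have -> : height (rtw a b v) (lfw a b v) (apw a b v) w = - ((apw a b v w).2 * sin (ang a b v)).
  by rewrite /height /lfw /pL /rtw /cross /padd /pscale /cis /= cos0 sin0; ring.
rewrite normrN normrM -[leRHS]mulr1; apply: ler_pM => //; exact: sin_max.
Qed.

(* Words of length [n = r ^ 48] are cut into [r ^ 32] windows of length [r ^ 16], for a grid of
   mesh [2 ^ - (r ^ 34)]. *)
Lemma P_count_growth r0 : (forall r, (r0 <= r)%N -> forall v w y2 y3,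
    (size y2 < r ^ 16)%N -> (size y3 < r ^ 16)%N ->
    area (apw a b v) w (y2 ++ w) (y3 ++ y2 ++ w) != 0 ->
    gap R (r ^ 16) r <= `|area (apw a b v) w (y2 ++ w) (y3 ++ y2 ++ w)| *
                        tanden a b ^+ (8 * r ^ 16 + 8)) ->
  forall v, exists r1, forall r, (r1 <= r)%N ->
    (P_count a b v (r ^ 48) <= ((2 ^ (2 * r ^ 34))%N)%:R%:E)%E.
Proof.
move=> hgap v; pose kappa := cross (rtw a b v [::]) (lfw a b v [::]).
have k0 : 0 < kappa := root_cross_gt0 hab v.
(* Constants depending on the triangle only, eventually dominated by [r]. *)
have [A0 hA0] := le_pow2 (3 / kappa); have [A1 hA1] := le_pow2 (tanden a b).
pose A := (A0 + A1)%N.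
have two_le m n : (m <= n)%N -> (2 : R) ^+ m <= 2 ^+ n by move=> mn; rewrite ler_weXn2l //; lra.
have kA : 3 / kappa <= 2 ^+ A by apply: le_trans hA0 (two_le _ _ _); rewrite leq_addr.
have TA : tanden a b <= 2 ^+ A by apply: le_trans hA1 (two_le _ _ _); rewrite leq_addl.
have T0 : 0 < tanden a b by apply: mulr_gt0; apply: ltr_pwDl => //; exact: sqr_ge0.
exists (r0 + A + 2000)%N => r rr.
have r00 : (r0 <= r)%N by lia.
have rA : (A + 2000 <= r)%N by lia.
have r20 : (20 <= r)%N by lia.
(* Heights are at most the word length plus 2, hence at most [4 * r ^ 48]. *)
pose B : R := (2 ^ (48 * r + 2))%:R.
have EN : (r ^ 32 * r ^ 16 = r ^ 48)%N by rewrite -expnD.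
have hB w : (size w < r ^ 32 * r ^ 16)%N ->
    `|height (rtw a b v) (lfw a b v) (apw a b v) w| <= B.
  rewrite EN => sw; apply: le_trans (height_le v w) _; rewrite ler_nat expnD.
  have aux (s N M : nat) : (s < N)%N -> (N <= M)%N -> (s.+2 <= M * 2 ^ 2)%N by lia.
  exact: aux sw (leq_exp2_pow r 48).
have hgap' w y2 y3 : (size y2 < r ^ 16)%N -> (size y3 < r ^ 16)%N ->
    area (apw a b v) w (y2 ++ w) (y3 ++ y2 ++ w) != 0 ->
    3 * B ^+ 2 / (kappa * (2 ^ (r ^ 34))%:R) < `|area (apw a b v) w (y2 ++ w) (y3 ++ y2 ++ w)|.
  move=> s2 s3 nz; have := hgap r r00 v w y2 y3 s2 s3 nz.
  set S := `|_|; set k := (8 * r ^ 16 + 8)%N => hS.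
  have Tk0 : 0 < tanden a b ^+ k by rewrite exprn_gt0.
  rewrite -(ltr_pM2r Tk0); apply: lt_le_trans hS.
  have -> : 3 * B ^+ 2 / (kappa * (2 ^ (r ^ 34))%:R) * tanden a b ^+ k =
      (3 / kappa) * B ^+ 2 * tanden a b ^+ k / 2 ^+ (r ^ 34).
    have nk := lt0r_neq0 k0; have n2 : (2 : R) ^+ (r ^ 34) != 0 by rewrite expf_neq0.
    by rewrite natrX; field; rewrite ?nk ?n2.
  rewrite ltr_pdivrMr ?exprn_gt0 // /gap exprVn [ltRHS]mulrC ltr_pdivlMr ?exprn_gt0 //.
  have Tk : tanden a b ^+ k <= 2 ^+ (A * k).
    by rewrite exprM; apply: lerXn2r TA; rewrite nnegrE ?exprn_ge0 // ltW.
  apply: (@le_lt_trans _ _ (2 ^+ A * 2 ^+ (2 * (48 * r + 2)) * 2 ^+ (A * k) *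
      2 ^+ ((3 * r ^ 16 + 10 + r) * (2 * (32 * r ^ 16 + 32))))).
    rewrite ler_wpM2r ?exprn_ge0 //; apply: ler_pM => //.
    - by rewrite !mulr_ge0 ?sqr_ge0 // invr_ge0 ltW.
    - exact: ltW.
    by rewrite /B natrX -exprM (mulnC _ 2%N) ler_wpM2r // exprn_ge0.
  by rewrite -!exprD ltr_eXn2l ?grid_exponent //; lra.
have K0 : (0 < 2 ^ (r ^ 34))%N by rewrite expn_gt0.
have cnt := alive_count_le (rtwS a b v) (lfwS a b v) (apw_beyond hab v) (root_cross_gt0 hab v)
  K0 hB hgap'.
rewrite EN in cnt.
have := P_count_le hab (fun t tn => cnt t (ltnW tn)) => /le_trans; apply.
by rewrite lee_fin ler_nat; exact: count_exponent r20.
Qed.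

(** For a lower limit the subsequence [n = r ^ 48] suffices; there the exponential weight beats
    [2 ^ (2 * r ^ 34)]. *)
Lemma P_count_liminf v (eps : R) : 0 < eps ->
  (exists r1, forall r, (r1 <= r)%N ->
    (P_count a b v (r ^ 48) <= ((2 ^ (2 * r ^ 34))%N)%:R%:E)%E) ->
  (limn_einf (fun n : nat => (P_count a b v n *
     (expR (- ((n%:R : R) `^ (Num.sqrt 3 - 1 + eps))))%:E)%E) < +oo)%E.
Proof.
move=> e0 [r1 hr1]; apply: (@le_lt_trans _ _ 1%E); last exact: ltry.
(* The summand 2 ensures [2 * r ^ 34 <= r ^ 35]. *)
apply: limn_einf_le => n0; pose r := (n0 + r1 + 2)%N.
have n0r : (n0 <= r ^ 48)%N.
  by rewrite (@leq_trans r) //; [rewrite /r; lia|rewrite -[leqLHS]expn1 leq_pexp2l // /r; lia].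
exists (r ^ 48)%N => //.
have Pr : (P_count a b v (r ^ 48) <= ((2 ^ (2 * r ^ 34))%N)%:R%:E)%E by apply: hr1; rewrite /r; lia.
have two_exp j : (2 ^ j)%:R <= expR (j%:R : R).
  rewrite natrX -[j%:R]mulr1 expRM_natl; apply: lerXn2r; rewrite ?nnegrE ?expR_ge0 //.
  by have := expR_ge1Dx (1 : R); lra.
have rR1 : 1 <= r%:R :> R by rewrite ler1n /r; lia.
have pow : (r%:R : R) ^+ 35 <= (r ^ 48)%:R `^ (Num.sqrt 3 - 1 + eps).
  rewrite natrX -!powR_mulrn ?ler0n // -powRrM; apply: ler_powR => //.
  by have := sqrt3_lower R; lra.
have N35 : (2 * r ^ 34)%:R <= (r%:R : R) ^+ 35.
  by rewrite -natrX ler_nat (expnS _ 34) leq_mul2r; apply/orP; right; rewrite /r; lia.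
apply: (@le_trans _ _ ((expR ((2 * r ^ 34)%:R : R))%:E *
    (expR (- ((r ^ 48)%:R `^ (Num.sqrt 3 - 1 + eps))))%:E)%E).
  apply: lee_wpmul2r; first by rewrite lee_fin expR_ge0.
  by apply: le_trans Pr _; rewrite lee_fin.
by rewrite -EFinM -expRD lee_fin expR_le1 subr_le0 (le_trans N35).
Qed.

End Growth.

Unset Implicit Arguments.

Theorem theorem4p1 (R : realType) :
  {ae ((@lebesgue_measure R) \x (@lebesgue_measure R))%E, forall ab : R * R,
    triangle_params ab ->
    forall (v : 'I_3) (eps : R), 0 < eps ->
      (limn_einf (fun n : nat =>
         (P_count ab.1 ab.2 v n *
          (expR (- ((n%:R : R) `^ (Num.sqrt 3 - 1 + eps))))%:E)%E)
       < +oo)%E}.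
Proof.
(* The window lengths [r ^ 16] are the same for all triangles, so a single null set is removed. *)
apply: negligibleS (@area_gap_ae R (fun r => r ^ 16)%N) => ab /= nok ok; apply: nok => hab v eps e0.
have [r0 hr0] := ok hab; apply: P_count_liminf => //.
by apply: P_count_growth hr0 v; case: (ab) hab.
Qed.
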